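(* Let $1\leq q\leq p\leq\infty$. Then every bounded domain $\Omega\subset\mathbb{R}^n$ that is an $(L^{1,p},L^{1,q})$-extension domain is also a $(W^{1,p},W^{1,q})$-extension domain.
   Context: A domain is a nonempty connected open set. For a domain $\Omega\subset\mathbb{R}^n$ and $1\leq p\leq\infty$, the homogeneous Sobolev space $L^{1,p}(\Omega)$ consists of all $u\in L^1_{\rm loc}(\Omega)$ whose distributional gradient $\nabla u$ belongs to $L^p(\Omega;\mathbb{R}^n)$, with semi-norm $\|u\|_{L^{1,p}(\Omega)}=\|\nabla u\|_{L^p(\Omega)}$. The Sobolev space $W^{1,p}(\Omega)$ consists of all $u\in L^{1,p}(\Omega)$ that also belong to $L^p(\Omega)$, with norm $\|u\|_{W^{1,p}(\Omega)}=\left(\int_\Omega |u|^p+|\nabla u|^p\,dx\right)^{1/p}$ for $p<\infty$ and $\|u\|_{W^{1,\infty}(\Omega)}=\operatorname{ess\,sup}_\Omega(|u|+|\nabla u|)$. For (semi-)normed function spaces $\mathcal{X}(\Omega)$ on $\Omega$ and $\mathcal{Y}(\mathbb{R}^n)$ on $\mathbb{R}^n$, $\Omega$ is an $(\mathcal{X},\mathcal{Y})$-extension domain if there exists a bounded extension operator $E:\mathcal{X}(\Omega)\to\mathcal{Y}(\mathbb{R}^n)$, that is, there is a constant $C>0$ such that for every $u\in\mathcal{X}(\Omega)$ one has $E(u)|_\Omega= u$ (almost everywhere) and $\|E(u)\|_{\mathcal{Y}(\mathbb{R}^n)}\leq C\|u\|_{\mathcal{X}(\Omega)}$. (Linearity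 of $E$ is not part of the definition.) *)

(* Defs.v *)
From HB Require Import structures.
From mathcomp Require Import all_boot all_order all_algebra.
From mathcomp Require Import all_classical all_reals all_analysis.
From mathcomp Require Import measurable_realfun ess_sup_inf lra.

Set Implicit Arguments.
Unset Strict Implicit.
Unset Printing Implicit Defensive.

Import Order.TTheory GRing.Theory Num.Theory.
Import numFieldNormedType.Exports.

Local Open Scope classical_set_scope.
Local Open Scope ring_scope.

Definition measure_rV_display : measure_display. Proof. exact. Qed.

Section rV_measurable.
Context {R : realType} {n : nat}.

Let coord (i : 'I_n) (x : 'rV[R]_n) : R := x ord0 i.

Let rV_set0 : g_sigma_preimage coord set0.
Proof. exact: sigma_algebra0. Qed.

Let rV_setC A : g_sigma_preimage coord A -> g_sigma_preimage coord (~` A).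
Proof. exact: sigma_algebraC. Qed.

Let rV_bigcup (F : _^nat) : (forall i, g_sigma_preimage coord (F i)) ->
  g_sigma_preimage coord (\bigcup_i (F i)).
Proof. exact: sigma_algebra_bigcup. Qed.

(* The product sigma-algebra, which is the Borel sigma-algebra of R^n: see
   [measurable_rVE]. *)
HB.instance Definition _ := @isMeasurable.Build measure_rV_display
  'rV[R]_n (g_sigma_preimage coord) rV_set0 rV_setC rV_bigcup.

Lemma measurable_coord (i : 'I_n) :
  measurable_fun [set: 'rV[R]_n] (fun x : 'rV[R]_n => x ord0 i).
Proof.
move=> _ Y mY; rewrite setTI; apply: sub_sigma_algebra => /=.
rewrite -bigcup_seq/=; exists i => /=; first by rewrite mem_index_enum.
by exists Y => //; rewrite setTI.
Qed.

Lemma measurable_fun_rV d (T : measurableType d) (f : T -> 'rV[R]_n) :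
  (forall i, measurable_fun [set: T] (fun t => f t ord0 i)) ->
  measurable_fun [set: T] f.
Proof.
move=> mf _ A; rewrite setTI; move: A.
suff : measurable `<=` [set A : set 'rV[R]_n | measurable (f @^-1` A)] by [].
apply: smallest_sub => /=.
  split=> /=.
  - by rewrite preimage_set0; exact: measurable0.
  - by move=> B; rewrite setTD preimage_setC => ?; exact: measurableC.
  - by move=> F mF; rewrite preimage_bigcup; exact: bigcup_measurable.
rewrite -bigcup_seq => B [i _ [C mC <-]] /=.
rewrite setTI -comp_preimage -[X in measurable X]setTI.
exact: (mf i measurableT C mC).
Qed.

Lemma measurable_ball_rV (x : 'rV[R]_n) (e : R) : measurable (ball x e).
Proof.
have [e0|e0] := leP e 0.
  rewrite (_ : ball x e = set0); first exact: measurable0.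
  by apply/seteqP; split=> // y [] /=; rewrite ltNge e0.
rewrite (_ : ball x e = \bigcap_(i in [set: 'I_n])
    ((fun y : 'rV[R]_n => y ord0 i) @^-1` ball (x ord0 i) e)); last first.
  apply/seteqP; split=> y.
    by move=> [_ xy] i _; exact: xy.
  by move=> xy; split=> // i j; rewrite (ord1 i); exact: xy.
apply: fin_bigcap_measurable => // i _.
rewrite -[X in measurable X]setTI; apply: measurable_coord => //.
exact: measurable_ball.
Qed.

Lemma open_measurable_rV (A : set 'rV[R]_n) : open A -> measurable A.
Proof.
move=> oA; pose q2R (v : 'rV[rat]_n) : 'rV[R]_n := map_mx ratr v.
rewrite (_ : A = \bigcup_vr (if `[< ball (q2R vr.1) (ratr vr.2) `<=` A >]
    then ball (q2R vr.1) (ratr vr.2) else set0)); last first.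
  apply/seteqP; split=> [x Ax|x [vr _]]; last first.
    by case: ifPn => // /asboolP sA /sA.
  have /nbhs_ballP[e /= e0 xeA] : nbhs x A by exact: open_nbhs_nbhs.
  have [r] := rat_in_itvoo (divr_gt0 e0 (ltr0Sn R 1)).
  rewrite in_itv/= => /andP[r0 re].
  have /choice[v vP] : forall i, exists v, `|x ord0 i - ratr v| < ratr r :> R.
    move=> i; have : x ord0 i - ratr r < x ord0 i + ratr r.
      by rewrite ltrBlDr -addrA ltrDl addr_gt0.
    move=> /rat_in_itvoo[v]; rewrite in_itv/= => /andP[v1 v2]; exists v.
    by rewrite ltr_norml ltrBlDr ltrBrDr; lra.
  have vx : ball (q2R (\row_i v i)) (ratr r) x.
    split=> // i j; rewrite (ord1 i) !mxE -ball_normE /= distrC; exact: vP.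
  exists (\row_i v i, r) => //=.
  case: ifPn => // /asboolPn; case; apply: subset_trans xeA => y vy.
  have := ball_triangle (ball_sym vx) vy; apply: le_ball.
  by lra.
apply: countable_bigcupT_measurable => // vr.
by case: ifPn => // _; exact: measurable_ball_rV.
Qed.

Lemma measurable_rVE : @measurable _ 'rV[R]_n = <<s (@open 'rV[R]_n) >>.
Proof.
apply/seteqP; split; last first.
  apply: smallest_sub; last exact: open_measurable_rV.
  exact: sigma_algebra_measurable.
apply: smallest_sub; first exact: smallest_sigma_algebra.
rewrite -bigcup_seq => B [i _ [C mC <-]] /=.
have : measurable_fun setT (coord i : g_sigma_algebraType (@open 'rV[R]_n) -> R).
  apply: (measurability _ (RGenOpens.measurableE R)) => //.
  move=> _ [_ [a [b ->]] <-]; apply: sub_sigma_algebra; rewrite setTI.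
  apply: open_comp; last exact: interval_open.
  by move=> x _; exact: coord_continuous.
by apply.
Qed.

End rV_measurable.

Section rV_measure_cons.
Context {R : realType} {n : nat}.
Local Open Scope ereal_scope.

Definition rV_cons (xt : 'rV[R]_n * R) : 'rV[R]_n.+1 :=
  row_mx (xt.2%:M : 'rV_1) xt.1.

Lemma rV_cons_ord0 xt : rV_cons xt ord0 ord0 = xt.2.
Proof.
rewrite /rV_cons (_ : ord0 = lshift n (ord0 : 'I_1)); last exact/val_inj.
by rewrite (row_mxEl (xt.2%:M : 'rV_1)) mxE.
Qed.

Lemma rV_cons_lift xt i : rV_cons xt ord0 (lift ord0 i) = xt.1 ord0 i.
Proof.
rewrite /rV_cons (_ : lift ord0 i = rshift 1 i); last exact/val_inj.
exact: (row_mxEr (xt.2%:M : 'rV_1)).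
Qed.

Lemma measurable_rV_cons : measurable_fun setT rV_cons.
Proof.
apply: measurable_fun_rV => i.
have [j ->|->] := unliftP ord0 i.
  rewrite (_ : (fun _ => _) = (fun x : 'rV[R]_n => x ord0 j) \o fst).
    by apply: measurableT_comp => //; exact: measurable_coord.
  by apply/funext => xt /=; rewrite rV_cons_lift.
rewrite (_ : (fun _ => _) = snd) //.
by apply/funext => xt /=; rewrite rV_cons_ord0.
Qed.

Variable m : {measure set 'rV[R]_n -> \bar R}.

Definition rV_measure_cons : set 'rV[R]_n.+1 -> \bar R :=
  pushforward (m \x (@lebesgue_measure R)) rV_cons.

Let cons0 : rV_measure_cons set0 = 0.
Proof. by rewrite /rV_measure_cons /pushforward preimage_set0 measure0. Qed.

Let cons_ge0 A : 0 <= rV_measure_cons A.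
Proof. exact: (measure_ge0 (m \x (@lebesgue_measure R))). Qed.

Let cons_sigma_additive : semi_sigma_additive rV_measure_cons.
Proof.
move=> F mF tF mUF; rewrite /rV_measure_cons /pushforward preimage_bigcup.
have mFc k : measurable (rV_cons @^-1` F k).
  by rewrite -[X in measurable X]setTI; exact: measurable_rV_cons.
apply: (@measure_semi_sigma_additive _ _ _
  (m \x (@lebesgue_measure R))%E (fun k => rV_cons @^-1` F k)) => //.
- apply/trivIsetP => /= i j _ _ ij; rewrite -preimage_setI.
  by move/trivIsetP : tF => /(_ _ _ _ _ ij) ->//; rewrite preimage_set0.
- by apply: bigcup_measurable => k _; exact: mFc.
Qed.

HB.instance Definition _ := isMeasure.Build _ _ _ rV_measure_cons
  cons0 cons_ge0 cons_sigma_additive.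

End rV_measure_cons.

(* Lebesgue measure on R^n, as the n-fold product of the one on R. *)
Fixpoint lebesgue_rV {R : realType} (n : nat) :
    {measure set 'rV[R]_n -> \bar R} :=
  match n with
  | 0 => dirac (0 : 'rV[R]_0)
  | n'.+1 => rV_measure_cons (lebesgue_rV n')
  end.

Lemma lebesgue_rV_box {R : realType} n (a b : 'rV[R]_n) :
  (forall i, a ord0 i <= b ord0 i) ->
  lebesgue_rV n [set x | forall i, a ord0 i <= x ord0 i <= b ord0 i] =
  (\prod_(i < n) (b ord0 i - a ord0 i))%:E.
Proof.
elim: n a b => [|n IH] a b ab.
  rewrite big_ord0 /= diracE mem_set //; by case.
pose tl (v : 'rV[R]_n.+1) : 'rV[R]_n := \row_i v ord0 (lift ord0 i).
pose box (u v : 'rV[R]_n) := [set x : 'rV[R]_n |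
  forall i, u ord0 i <= x ord0 i <= v ord0 i].
have mbox u v : measurable (box u v).
  rewrite (_ : box u v = \bigcap_(i in [set: 'I_n])
      ((fun x : 'rV[R]_n => x ord0 i) @^-1` `[u ord0 i, v ord0 i])).
    apply: fin_bigcap_measurable => // i _.
    by rewrite -[X in measurable X]setTI; exact: measurable_coord.
  apply/seteqP; split=> x /= xuv i; first by move=> _ /=; rewrite in_itv/=.
  by have := xuv i Logic.I; rewrite /= in_itv.
rewrite /= /rV_measure_cons /pushforward.
rewrite (_ : _ @^-1` _ = box (tl a) (tl b) `*` `[a ord0 ord0, b ord0 ord0]).
  rewrite product_measure1E // IH; last by move=> i; rewrite !mxE.
  rewrite /= lebesgue_measure_itv /= lte_fin big_ord_recl mulrC EFinM.
  congr (_ * _)%E; first by congr EFin; apply: eq_bigr => i _; rewrite !mxE.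
  have := ab ord0; rewrite le_eqVlt => /predU1P[->|->//].
  by rewrite ltxx subrr.
apply/seteqP; split=> -[x t] /=.
  move=> xab; split => [i|].
    by have := xab (lift ord0 i); rewrite rV_cons_lift !mxE.
  by have := xab ord0; rewrite rV_cons_ord0 in_itv.
move=> [xab]; rewrite in_itv => tab i.
have [j ->|->] := unliftP ord0 i; last by rewrite rV_cons_ord0.
by rewrite rV_cons_lift; have := xab j; rewrite !mxE.
Qed.

Section sobolev.
Context {R : realType} {n : nat}.
Local Notation E := 'rV[R]_n.
Local Notation mu := (@lebesgue_rV R n).
Implicit Types (Omega : set E) (u v f phi : E -> R) (g : E -> E) (p : \bar R).

Definition is_domain Omega := [/\ Omega !=set0, open Omega & connected Omega].

(* The library's norm on row vectors is the max norm. *)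
Definition enorm (x : E) : R := Num.sqrt (\sum_(i < n) x ord0 i ^+ 2).

Definition partial (i : 'I_n) f : E -> R :=
  fun x => 'D_(delta_mx ord0 i : E) f x.

(* C^oo: all iterated partial derivatives exist and are differentiable (hence
   continuous) everywhere. *)
Definition smooth f :=
  forall (s : seq 'I_n) (x : E), differentiable (foldr partial f s) x.

Definition test_function Omega phi :=
  [/\ smooth phi, compact (closure [set x | phi x != 0]) &
      closure [set x | phi x != 0] `<=` Omega].

(* Functions on [Omega] are represented by functions on the whole space whose
   values outside [Omega] are ignored. Measurability is Borel measurability,
   which loses nothing: every Lebesgue measurable function is equal almost
   everywhere to a Borel one. *)
Definition L1loc Omega : set (E -> R) :=
  [set u | measurable_fun Omega u /\
    forall K, compact K -> K `<=` Omega -> mu.-integrable K (EFin \o u)].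

Lemma restrict_out0 Omega f x : ~ Omega x -> (f \_ Omega) x = 0.
Proof. by move=> Ox; rewrite patchE memNset. Qed.

(* [f \_ Omega] is [f] on [Omega] and 0 elsewhere, see [restrict_out0]; this
   computes the L^p norm over [Omega], including for p = +oo. *)
Definition Lpnorm Omega p f : \bar R := 'N[mu]_p[EFin \o (f \_ Omega)].

Definition Lp Omega p : set (E -> R) :=
  [set f | measurable_fun Omega f /\ (Lpnorm Omega p f < +oo)%E].

Definition weak_gradient Omega u : set (E -> E) :=
  [set g | forall i : 'I_n, L1loc Omega (fun x => g x ord0 i) /\
    forall phi, test_function Omega phi ->
      \int[mu]_(x in Omega) (u x * partial i phi x) =
      - \int[mu]_(x in Omega) (g x ord0 i * phi x)].

(* Weak gradients are unique up to equality almost everywhere on [Omega], so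
   that the (semi-)norms below do not depend on the one picked here. *)
Definition grad Omega u : E -> E := xget (fun=> 0) (weak_gradient Omega u).

Record fspace := FSpace {
  fmem : set (E -> R) ;
  fnorm : (E -> R) -> \bar R }.

Definition L1p p Omega : fspace := {|
  fmem := [set u | L1loc Omega u /\
    exists2 g, weak_gradient Omega u g & Lp Omega p (enorm \o g)] ;
  fnorm := fun u => Lpnorm Omega p (enorm \o grad Omega u) |}.

(* The last case of the match is p = +oo; p = -oo is irrelevant since p >= 1. *)
Definition W1p p Omega : fspace := {|
  fmem := [set u | fmem (L1p p Omega) u /\ Lp Omega p u] ;
  fnorm := fun u =>
    match p with
    | r%:E => ((\int[mu]_(x in Omega)
        (`|u x| `^ r + enorm (grad Omega u x) `^ r)%:E) `^ r^-1)%E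
    | _ => ess_sup mu
        (EFin \o ((fun x => `|u x| + enorm (grad Omega u x)) \_ Omega))
    end |}.

Definition ae_eq_on Omega u v := {ae mu, forall x, Omega x -> u x = v x}.

(* The elements of the function spaces are classes of functions on [Omega] modulo
   equality almost everywhere; the second clause says that [T] is well defined
   on these classes. *)
Definition extension_domain (X Y : set E -> fspace) Omega :=
  exists T : (E -> R) -> (E -> R),
    [/\ forall u, fmem (X Omega) u -> fmem (Y setT) (T u),
        forall u v, fmem (X Omega) u -> fmem (X Omega) v ->
          ae_eq_on Omega u v -> ae_eq_on setT (T u) (T v),
        forall u, fmem (X Omega) u -> ae_eq_on Omega (T u) u &
        exists2 C : R, 0 < C & forall u, fmem (X Omega) u ->
          (fnorm (Y setT) (T u) <= C%:E * fnorm (X Omega) u)%E].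

End sobolev.

(* Main.v *)
(* The extension operator is [u |-> psi * T u], with [T] the given operator and
   [psi] a cutoff equal to 1 on the bounded domain. What is missing is an L^q
   bound for [v = T u] on the support of [psi] in terms of its L^q norm on the
   domain and of [|grad v|_q]. If [g] is a weak gradient of [v] on R^n then
   [v (x + h e_i) - v x = h * \int_0^1 g_i (x + s h e_i) ds] for almost every
   [x], hence the translate of [v] by [z] differs from [v] in L^q by at most a
   constant, depending on [z], times [|g|_q]. An L^q bound on a ball contained in
   the domain thus spreads to all balls of the same radius, hence to any compact
   set, and [q <= p] allows one to pass from L^p to L^q on the bounded domain. *)

From HB Require Import structures.
From mathcomp Require Import all_boot all_order all_algebra finmap.
From mathcomp Require Import all_classical all_reals all_analysis.
From mathcomp Require Import measurable_realfun ess_sup_inf ring lra.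
Require Import Defs.

Set Implicit Arguments.
Unset Strict Implicit.
Unset Printing Implicit Defensive.

Import Order.TTheory GRing.Theory Num.Theory.
Import numFieldNormedType.Exports.

Local Open Scope classical_set_scope.
Local Open Scope ring_scope.

(** * Smooth functions with compact support *)

(** The semi-norm of [L1p] does not see constants: the extension of the function 1 may be 1 on all
    of R^n. So [T u] need not be in L^q(R^n), which forces the cutoff. Nor can a mean value be
    subtracted before extending, since [T] need not be linear: the only hold on the size of [T u] is
    its equality with [u] on the domain. The domain comes with no boundary regularity from which to
    get a Poincare inequality, whereas translations can be compared freely on R^n. The weak gradient
    is known only through test functions, so the difference formula is proved by duality. Fubini and
    translation invariance move the segment average from the gradient onto the test function. For a
    product of one-variable bumps, [h] times this average is up to sign a difference of primitives,
    compactly supported, whose i-th derivative is the translation difference of the product. Such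
    products are enough, because they approximate the indicators of boxes and boxes generate the
    Borel sets. *)

Section bump1.
Context {R : realType}.
Implicit Types (t a b c : R) (f g : R -> R).

(* The factor [t ^- k] makes the family closed under differentiation. *)
Definition expinv (k : nat) t : R := if 0 < t then t ^- k * expR (- t^-1) else 0.

Lemma expinv_ge0 k t : 0 <= expinv k t.
Proof.
rewrite /expinv; case: ifPn => // t0.
by rewrite mulr_ge0 ?expR_ge0// invr_ge0 exprn_ge0// ltW.
Qed.

Lemma expinv0_le1 t : expinv 0 t <= 1.
Proof.
rewrite /expinv; case: ifPn => // t0.
by rewrite expr0 invr1 mul1r -[leRHS]expR0 ler_expR oppr_le0 invr_ge0 ltW.
Qed.

Lemma expinv_gt0 k t : (0 < expinv k t) = (0 < t).
Proof.
rewrite /expinv; case: ifPn => t0; last by rewrite ltxx.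
by rewrite mulr_gt0 ?expR_gt0// invr_gt0 exprn_gt0.
Qed.

(** One term of the exponential series bounds exp(1/t) below by t^-(k+2) / (k+2)!. The square on the
    right makes the difference quotient at 0 tend to 0. *)
Lemma expinv_le_sqr k t : expinv k t <= (k.+2)`!%:R * t ^+ 2.
Proof.
rewrite /expinv; case: ifPn => [t0|_]; last by rewrite mulr_ge0// sqr_ge0.
have t'0 : 0 <= t^-1 by rewrite invr_ge0 ltW.
have h : t ^- k.+2 <= (k.+2)`!%:R * expR t^-1.
  have := expR_ge1Dxn k.+1 t'0.
  rewrite exprVn => h; rewrite -ler_pdivrMl ?ltr0n ?fact_gt0// mulrC.
  by apply: le_trans h; rewrite lerDr ler01.
rewrite expRN ler_pdivrMr ?expR_gt0//.
have -> : t ^- k = t ^- k.+2 * t ^+ 2.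
  by rewrite -addn2 exprD invfM -mulrA mulVf ?mulr1// expf_neq0// gt_eqF.
by rewrite mulrAC ler_wpM2r// sqr_ge0.
Qed.

Lemma is_derive_expinv k t :
  is_derive t 1 (expinv k) (- k%:R * expinv k.+1 t + expinv k.+2 t).
Proof.
have [t0|t0|t0] := ltrgtP 0 t.
- apply: (@near_eq_is_derive R R^o R^o (fun s => (s ^+ k)^-1 * expR (- s^-1))).
    near=> s; rewrite /expinv ifT//; near: s; exact: lt_nbhsr.
  have tk0 : t ^+ k != 0 by rewrite expf_neq0// gt_eqF.
  have tn0 : t != 0 by rewrite gt_eqF.
  have d1 : is_derive t 1 (fun s : R => (s ^+ k)^-1)
      (- (t ^+ k) ^- 2 *: ((k%:R * t ^+ k.-1) *: 1)).
    apply: is_deriveV => //. rewrite (_ : _^~ k = (id : R -> R) ^+ k); last by apply/funext => s; rewrite exprfctE.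
    exact: is_deriveX.
  have dV : is_derive t 1 (fun s : R => s^-1) (- t ^- 2 *: 1) by exact: is_deriveV.
  have dN : is_derive t 1 (fun s : R => - s^-1) (- (- t ^- 2 *: 1)) by exact: is_deriveN.
  have d2 : is_derive t 1 (fun s : R => expR (- s^-1))
      (expR (- t^-1) * (- (- t ^- 2 *: 1))) by exact: is_derive1_comp.
  apply: (is_derive_eq (is_deriveM d1 d2)).
  rewrite /expinv t0 /GRing.scale /= !mulr1 opprK.
  case: k {d1 d2} tk0 => [|k] tk0.
    by rewrite expr0 !mul0r mulr0 oppr0 mul0r mulr0 addr0 add0r invr1 mul1r mulrC.
  move: tk0; rewrite /= !exprS expr0; move: (expR _) (k.+1%:R) (t ^+ k) => E K X tk0.
  have X0 : X != 0 by apply: contraNN tk0 => /eqP->; rewrite mulr0.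
  by field; rewrite X0 tn0.
- rewrite /expinv !ltNge (ltW t0)/= mulr0 addr0.
  have d0 : is_derive t 1 (cst (0:R)) 0 by exact: is_derive_cst.
  apply: near_eq_is_derive d0.
  near=> s; rewrite [RHS]ifF//; apply/negbTE; rewrite -leNgt ltW//; near: s.
  exact: lt_nbhsl.
- rewrite -t0.
  have e0 j : expinv j 0 = 0 :> R by rewrite /expinv ltxx.
  rewrite !e0 mulr0 addr0.
  (* By [expinv_le_sqr] the quotient is at most (k+2)! |h|. *)
  have cv : h^-1 *: (expinv k (h *: (1:R) + 0) - expinv k 0) @[h --> 0^'] --> (0:R).
    apply/cvgr0Pnorm_lt => e e1; near=> h.
    have hn0 : h != 0 by near: h; exact: nbhs_dnbhs_neq.
    rewrite e0 subr0 addr0 /GRing.scale/= mulr1 normrM normfV.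
    rewrite mulrC ltr_pdivrMr ?normr_gt0// ger0_norm ?expinv_ge0//.
    apply: le_lt_trans (expinv_le_sqr _ _) _.
    rewrite -(normr_id h) -real_normK ?num_real// normr_id expr2 mulrA.
    rewrite ltr_pM2r ?normr_gt0// mulrC -ltr_pdivlMr ?ltr0n ?fact_gt0//.
    near: h; apply: dnbhs0_lt; by rewrite divr_gt0// ltr0n fact_gt0.
  apply: DeriveDef; first by apply/cvg_ex; exists 0.
  exact/cvg_lim.
Unshelve. all: by end_near. Qed.

End bump1.

Section smooth_classes.
Context {R : realType}.
Implicit Types (t a b c : R) (f g : R -> R).

(* The last constructor keeps the class closed under taking primitives, needed
   for plateau functions and for [bump_primitive]. *)
Inductive smooth1 : (R -> R) -> Prop :=
| smooth1_expinv k a b : smooth1 (fun t => expinv k (a * t + b))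
| smooth1_cst c : smooth1 (fun=> c)
| smooth1D f g : smooth1 f -> smooth1 g -> smooth1 (fun t => f t + g t)
| smooth1M f g : smooth1 f -> smooth1 g -> smooth1 (fun t => f t * g t)
| smooth1_primitive f g : smooth1 g -> (forall t, is_derive t 1 f (g t)) ->
    smooth1 f.

Lemma is_derive_affine a b t : is_derive t 1 (fun s : R => a * s + b) a.
Proof.
have dZ : is_derive t 1 (a \*: (id : R -> R)) (a *: (1:R)) by exact: is_deriveZ.
have dc : is_derive t 1 (cst b) (0 : R) by exact: is_derive_cst.
by apply: (is_derive_eq (is_deriveD dZ dc)); rewrite addr0 /GRing.scale/= mulr1.
Qed.

Lemma smooth1_derive f : smooth1 f ->
  exists2 g, smooth1 g & forall t, is_derive t 1 f (g t).
Proof.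
elim=> {f} [k a b|c|f g sf [f' sf' df] sg [g' sg' dg]|
  f g sf [f' sf' df] sg [g' sg' dg]|f g sg _ dfg].
- exists (fun t => (- k%:R * expinv k.+1 (a * t + b) + expinv k.+2 (a * t + b)) * a).
    do !constructor.
  move=> t; have := is_derive_affine a b t; apply: is_derive1_comp.
  exact: is_derive_expinv.
- exists (fun=> 0); first exact: smooth1_cst.
  move=> t; exact: is_derive_cst.
- exists (fun t => f' t + g' t); first exact: smooth1D.
  by move=> t; exact: is_deriveD.
- exists (fun t => f t * g' t + g t * f' t).
    by apply: smooth1D; apply: smooth1M.
  by move=> t; exact: is_deriveM.
- by exists g.
Qed.

Lemma smooth1_continuous f : smooth1 f -> continuous f.
Proof.
move=> /smooth1_derive[g _ df] t; apply: differentiable_continuous.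
by apply/derivable1_diffP; case: (df t).
Qed.

Section nD.
Variable n : nat.
Local Notation E := 'rV[R]_n.
Implicit Types (u v w : E -> R).

(** [smooth] quantifies over words of partial derivatives, which gives no direct induction for
    products. This class is stable under [partial] by construction, and [smoothnE] leads back to
    [smooth]. The first constructor admits arbitrary smooth functions, as [test_functionM]
    requires. *)
Inductive smoothn : (E -> R) -> Prop :=
| smoothn_smooth u : smooth u -> smoothn u
| smoothn_cst c : smoothn (fun=> c)
| smoothn_coord i f : smooth1 f -> smoothn (fun x => f (x ord0 i))
| smoothnD u v : smoothn u -> smoothn v -> smoothn (fun x => u x + v x)
| smoothnM u v : smoothn u -> smoothn v -> smoothn (fun x => u x * v x).

Lemma differentiable_smooth1_coord i f x : smooth1 f ->
  differentiable (fun x : E => f (x ord0 i)) x.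
Proof.
move=> /smooth1_derive[g _ df].
apply: (@differentiable_comp _ _ _ _ (fun x : E => x ord0 i) f).
  exact: differentiable_coord.
by apply/derivable1_diffP; case: (df (x ord0 i)).
Qed.

Lemma partial_smooth1_coord i j f g x : (forall t, is_derive t 1 f (g t)) ->
  partial i (fun x : E => f (x ord0 j)) x = g (x ord0 j) * (i == j)%:R.
Proof.
move=> df.
have -> : partial i (fun x : E => f (x ord0 j)) x = 'D_((i == j)%:R : R) f (x ord0 j).
  rewrite /partial /derive; set u := (X in lim (X @ _) = _).
  rewrite (_ : u = fun h => h^-1 *: ((f \o shift (x ord0 j)) (h *: (i == j)%:R) - f (x ord0 j)))//.
  by apply/funext => h; rewrite /u /= !mxE eqxx/= (eq_sym j).
have [_|_] := eqVneq i j; last by rewrite derive0 mulr0.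
by rewrite mulr1; have [_ <-] := df (x ord0 j).
Qed.

Lemma smoothn_differentiable u x : smoothn u -> differentiable u x.
Proof.
elim=> {u} [u su|c|i f sf|u v _ du _ dv|u v _ du _ dv].
- exact: (su [::]).
- exact: differentiable_cst.
- exact: differentiable_smooth1_coord.
- exact: differentiableD.
- exact: differentiableM.
Qed.

Lemma smoothn_partial i u : smoothn u -> smoothn (partial i u).
Proof.
elim=> {u} [u su|c|j f /smooth1_derive[g sg df]|u v su su' sv sv'|u v su su' sv sv'].
(* Appending [i] at the end of the word applies [partial i] first. *)
- by apply: smoothn_smooth => s x; have := su (rcons s i) x; rewrite foldr_rcons.
- rewrite (_ : partial _ _ = fun=> 0); first exact: smoothn_cst.
  by apply/funext => x; rewrite /partial derive_cst.
- rewrite (_ : partial _ _ = fun x => g (x ord0 j) * (i == j)%:R); last first.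
    by apply/funext => x; exact: partial_smooth1_coord.
  by apply: smoothnM; [exact: smoothn_coord|exact: smoothn_cst].
- rewrite (_ : partial _ _ = fun x => partial i u x + partial i v x).
    exact: smoothnD.
  by apply/funext => x; rewrite /partial deriveD//; apply: diff_derivable;
    exact: smoothn_differentiable.
- rewrite (_ : partial _ _ = fun x => u x * partial i v x + v x * partial i u x).
    by apply: smoothnD; apply: smoothnM.
  by apply/funext => x; rewrite /partial deriveM//; apply: diff_derivable;
    exact: smoothn_differentiable.
Qed.

Lemma smoothnE u : smoothn u -> smooth u.
Proof.
move=> su s x; apply: smoothn_differentiable.
by elim: s => //= i s; exact: smoothn_partial.
Qed.

Lemma smoothn_prod (I : Type) (r : seq I) (u : I -> E -> R) :
  (forall i, smoothn (u i)) -> smoothn (fun x => \prod_(i <- r) u i x).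
Proof.
move=> su; elim: r => [|i r ih].
  by under eq_fun do rewrite big_nil; exact: smoothn_cst.
by under eq_fun do rewrite big_cons; exact: smoothnM.
Qed.

Lemma partialM i u v x : smooth u -> smooth v ->
  partial i (fun y => u y * v y) x = u x * partial i v x + v x * partial i u x.
Proof.
by move=> /(_ [::]) su /(_ [::]) sv; rewrite /partial deriveM//;
  exact: diff_derivable.
Qed.

Lemma smooth_continuous u : smooth u -> continuous u.
Proof. by move=> /(_ [::]) su x; exact: differentiable_continuous. Qed.

Lemma smooth_partial i u : smooth u -> smooth (partial i u).
Proof. by move=> /smoothn_smooth/(smoothn_partial i)/smoothnE. Qed.

End nD.
End smooth_classes.

(** * Primitives of compactly supported functions *)

Section primitive.
Context {R : realType}.
Local Notation mu := (@lebesgue_measure R).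
Implicit Types (t a b h : R) (f : R -> R).

Definition supported f a b := forall t, f t != 0 -> a <= t <= b.

(** With lower limit -oo the primitive is 0 to the left of the support and constant to its right, so
    the difference of two translates has compact support again. *)
Definition primitive f t : R := \int[mu]_(s in `]-oo, t]) f s.

Lemma supported_integrable f a b : continuous f -> supported f a b ->
  mu.-integrable setT (EFin \o f).
Proof.
move=> cf sf.
have -> : EFin \o f = (EFin \o f) \_ `[a, b].
  apply/funext => t; rewrite patchE/=; case: ifPn => // /negP tab.
  congr EFin; apply/eqP/negPn/negP => /sf tab'; apply: tab.
  by rewrite inE/= in_itv.
apply/integrable_restrict => //; rewrite setTI.
apply: continuous_compact_integrable; first exact: segment_compact.
exact: continuous_subspaceT.
Qed.

Lemma is_derive_primitive f a b t : continuous f -> supported f a b ->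
  is_derive t 1 (primitive f) (f t).
Proof.
move=> cf sf.
have tt : t < t + 1 by rewrite ltrDl.
have fi : mu.-integrable `]-oo, t + 1] (EFin \o f).
  exact: integrableS (supported_integrable cf sf).
have [df dE] := continuous_FTC1 tt fi (ltNyr t) (cf t).
by apply: DeriveDef; [exact: df|rewrite -derive1E; exact: dE].
Qed.

Lemma primitive_lt f a b t : supported f a b -> t < a -> primitive f t = 0.
Proof.
move=> sf ta; rewrite /primitive (@eq_Rintegral _ _ _ _ _ (cst 0)).
  by rewrite Rintegral_cst// mul0r.
move=> s; rewrite inE/= in_itv/= => st; apply/eqP/negPn/negP => /sf /andP[].
by rewrite leNgt (le_lt_trans st ta).
Qed.

Lemma primitive_gt f a b t : continuous f -> supported f a b -> b <= t ->
  primitive f t = \int[mu]_s f s.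
Proof.
move=> cf sf bt; rewrite /primitive.
rewrite Rintegral_mkcond; apply: eq_Rintegral => s _; rewrite patchE.
case: ifPn => //; rewrite notin_setE/= in_itv/= => /negP st.
apply/esym/eqP/negPn/negP => /sf /andP[_ sb].
by move: st; rewrite (le_trans sb bt).
Qed.

Lemma supported_primitiveB f a b h h' : continuous f -> supported f a b ->
  supported (fun t => primitive f (t + h) - primitive f (t + h'))
    (a - (`|h| + `|h'|)) (b + (`|h| + `|h'|)).
Proof.
move=> cf sf t; have := ler_norm h; have := ler_norm h'.
have := ler_norm (- h); have := ler_norm (- h'); rewrite !normrN => h1 h2 h3 h4.
apply: contraNT; rewrite negb_and -!ltNge => /orP[ta|ta].
  by rewrite !(primitive_lt sf) ?subrr//; lra.
by rewrite !(primitive_gt cf sf) ?subrr//; lra.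
Qed.

Lemma smooth1_shift f h : smooth1 f -> smooth1 (fun t => f (t + h)).
Proof.
elim=> {f} [k a b|c|f g _ sf _ sg|f g _ sf _ sg|f g _ sg df].
- rewrite (_ : (fun _ => _) = fun t => expinv k (a * t + (a * h + b))).
    exact: smooth1_expinv.
  by apply/funext => t; congr expinv; ring.
- exact: smooth1_cst.
- exact: smooth1D.
- exact: smooth1M.
- apply: (smooth1_primitive sg) => t.
  have dh : is_derive t 1 (fun s : R => s + h) (1:R).
    rewrite (_ : (fun _ => _) = fun s : R => 1 * s + h).
      exact: is_derive_affine.
    by apply/funext => s; rewrite mul1r.
  by have := @is_derive1_comp _ f (+%R^~ h) t _ _ (df (t + h)) dh; rewrite mulr1.
Qed.

Lemma smooth1_primitiveB f a b h h' : smooth1 f -> supported f a b ->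
  smooth1 (fun t => primitive f (t + h) - primitive f (t + h')).
Proof.
move=> sf sfab.
have sP : smooth1 (primitive f).
  apply: (smooth1_primitive sf) => t.
  exact: (is_derive_primitive _ (smooth1_continuous sf) sfab).
rewrite (_ : (fun _ => _) = fun t => primitive f (t + h) + (-1) * primitive f (t + h')).
  apply: smooth1D; first exact: smooth1_shift.
  by apply: smooth1M; [exact: smooth1_cst|exact: smooth1_shift].
by apply/funext => t; rewrite mulN1r.
Qed.

End primitive.

Section tensor.
Context {R : realType} {n : nat}.
Local Notation E := 'rV[R]_n.
Implicit Types (f : 'I_n -> R -> R) (a b x : E).

Definition cbox a b := [set x : E | forall i, a ord0 i <= x ord0 i <= b ord0 i].

Lemma closed_cbox a b : closed (cbox a b).
Proof.
rewrite (_ : cbox a b = \bigcap_(i in [set: 'I_n])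
    ((fun x : E => x ord0 i) @^-1` `[a ord0 i, b ord0 i])).
  apply: closed_bigI => i _; apply: preimage_closed; last exact: interval_closed.
  by move=> x _; exact: coord_continuous.
apply/seteqP; split=> x /= xab i; first by move=> _ /=; rewrite in_itv/=.
by have := xab i Logic.I; rewrite /= in_itv.
Qed.

Lemma compact_cbox a b : compact (cbox a b).
Proof.
have := @rV_compact R n (fun i => `[a ord0 i, b ord0 i]%classic)
  (fun i => @segment_compact R _ _).
congr compact; apply/seteqP; split=> x /= xab i; have := xab i; by rewrite in_itv.
Qed.

Definition tensor f x : R := \prod_(i < n) f i (x ord0 i).

Lemma smooth_tensor f : (forall i, smooth1 (f i)) -> smooth (tensor f).
Proof.
by move=> sf; apply/smoothnE/smoothn_prod => i; exact: smoothn_coord.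
Qed.

Lemma partial_tensor i f (g : R -> R) x : (forall t : R, is_derive t 1 (f i) (g t)) ->
  partial i (tensor f) x = tensor (fun j => if j == i then g else f j) x.
Proof.
(* Along the i-th direction the other factors form the constant [K]. *)
move=> df; pose K := \prod_(j < n | j != i) f j (x ord0 j).
have -> : partial i (tensor f) x = 'D_(1 : R) (K \*: f i) (x ord0 i).
  rewrite /partial /derive; set u := (X in lim (X @ _) = _).
  rewrite (_ : u = fun h => h^-1 *: (((K \*: f i) \o shift (x ord0 i)) (h *: (1:R)) - (K \*: f i) (x ord0 i)))//.
  apply/funext => h; rewrite /u /= /tensor.
  rewrite (bigD1 i)//= [X in _ - X](bigD1 i)//= !mxE !eqxx/=.
  rewrite -/K (eq_bigr (fun j => f j (x ord0 j))) -/K.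
    by rewrite !(mulrC _ K).
  by move=> j ji; rewrite !mxE (negbTE ji) andbF mulr0 add0r.
rewrite deriveZ; last by case: (df (x ord0 i)).
have [_ ->] := df (x ord0 i).
rewrite /tensor (bigD1 i)//= eqxx mulrC; congr (_ * _).
by apply: eq_bigr => j /negbTE ->.
Qed.

Lemma tensor_neq0 f a b x : (forall i, supported (f i) (a ord0 i) (b ord0 i)) ->
  tensor f x != 0 -> cbox a b x.
Proof.
move=> sf /prodf_neq0 fx i; apply: sf; exact: fx.
Qed.

Lemma test_function_tensor f a b : (forall i, smooth1 (f i)) ->
  (forall i, supported (f i) (a ord0 i) (b ord0 i)) ->
  test_function setT (tensor f).
Proof.
move=> sf fab; split => //; first exact: smooth_tensor.
apply: (@subclosed_compact _ _ (cbox a b)).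
- exact: closed_closure.
- exact: compact_cbox.
rewrite (closure_id (cbox a b)).1; last exact: closed_cbox.
by apply: closure_subset => x /=; exact: tensor_neq0.
Qed.

End tensor.

(** * Cutoffs and smooth approximations of intervals *)

Section cutoff.
Context {R : realType}.
Local Notation mu := (@lebesgue_measure R).
Implicit Types (t a b k L : R).

Definition bump k a b t : R := expinv 0 (k * (t - a)) * expinv 0 (k * (b - t)).

Lemma smooth1_bump k a b : smooth1 (bump k a b).
Proof.
apply: smooth1M.
  rewrite (_ : (fun _ => _) = fun t => expinv 0 (k * t + - (k * a))).
    exact: smooth1_expinv.
  by apply/funext => t; rewrite mulrBr.
rewrite (_ : (fun _ => _) = fun t => expinv 0 (- k * t + k * b)).
  exact: smooth1_expinv.
by apply/funext => t; rewrite mulrBr addrC mulNr.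
Qed.

Lemma bump_ge0 k a b t : 0 <= bump k a b t.
Proof. by rewrite mulr_ge0// expinv_ge0. Qed.

Lemma bump_le1 k a b t : bump k a b t <= 1.
Proof. by rewrite mulr_ile1// ?expinv_ge0// expinv0_le1. Qed.

Lemma bump_gt0 k a b t : 0 < k -> (0 < bump k a b t) = (a < t < b).
Proof.
move=> k0; rewrite /bump.
have -> : (a < t) = (0 < expinv 0 (k * (t - a))).
  by rewrite expinv_gt0 pmulr_rgt0// subr_gt0.
have -> : (t < b) = (0 < expinv 0 (k * (b - t))).
  by rewrite expinv_gt0 pmulr_rgt0// subr_gt0.
move: (expinv_ge0 0 (k * (t - a))) (expinv_ge0 0 (k * (b - t))).
rewrite le_eqVlt => /predU1P[<-|at0]; first by rewrite mul0r ltxx.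
by rewrite at0 /= pmulr_rgt0.
Qed.

Lemma bump_supported k a b : 0 < k -> supported (bump k a b) a b.
Proof.
move=> k0 t; rewrite neq_lt ltNge bump_ge0/= bump_gt0// => /andP[ta tb].
by rewrite !ltW.
Qed.

(** Take the primitive F of a bump on [-1, 1] and normalize F(t + L + 2) - F(t - L - 2). For |t| <=
    L the first term has reached its final value and the second is still 0. The number 5 is the
    radius 1 of the bump plus twice the shift margin 2. *)
Lemma exists_plateau L : 0 < L -> exists f : R -> R,
  [/\ smooth1 f, supported f (- (L + L + 5)) (L + L + 5) &
      forall t, - L <= t <= L -> f t = 1].
Proof.
move=> L0; pose f := bump 1 (-1) 1; pose c : R := \int[mu]_s f s.
have cf : continuous f by exact: smooth1_continuous (smooth1_bump _ _ _).
have sf : supported f (-1) 1 by exact: bump_supported.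
have dF t := is_derive_primitive t cf sf.
(* The primitive is nonnegative at -1, strictly increasing on [-1, 1], and equal to [c] at 1. *)
have c0 : 0 < c.
  rewrite /c -(primitive_gt cf sf (lexx 1)).
  apply: (@le_lt_trans _ _ (primitive f (- 1))).
    by apply: Rintegral_ge0 => t _; exact: bump_ge0.
  apply: (@gtr0_derive1_incr _ (primitive f) (-1) 1) => //; try lra.
  - move=> t; rewrite in_itv/= => t1; have [_] := dF t.
    by rewrite derive1E => ->; rewrite bump_gt0.
  - apply: continuous_subspaceT => t; apply: differentiable_continuous.
    by apply/derivable1_diffP; case: (dF t).
exists (fun t => c^-1 * (primitive f (t + (L + 2)) - primitive f (t + - (L + 2)))).
split.
- apply: smooth1M; first exact: smooth1_cst.
  exact: (smooth1_primitiveB _ _ (smooth1_bump _ _ _) sf).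
- move=> t; rewrite mulf_eq0 negb_or => /andP[_].
  move=> /(supported_primitiveB cf sf); rewrite normrN gtr0_norm; last by lra.
  by move=> /andP[]; lra.
- move=> t tL; rewrite (primitive_gt cf sf); last by lra.
  rewrite (primitive_lt sf); last by lra.
  by rewrite subr0 mulVf// gt_eqF.
Qed.

(* As [m] grows this tends pointwise to the indicator function of [a, b]: the
   slope [(m + 1) ^ 2] times the margin [1 / (m + 1)] tends to infinity. *)
Definition boxbump (m : nat) a b : R -> R :=
  bump (m.+1%:R ^+ 2) (a - m.+1%:R^-1) (b + m.+1%:R^-1).

Lemma boxbump_supported m a b : supported (boxbump m a b) (a - 1) (b + 1).
Proof.
move=> t /bump_supported; rewrite exprn_gt0// => /(_ isT) /andP[ta tb].
have m1 : (m.+1%:R^-1 : R) <= 1 by rewrite invf_le1// ler1n.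
by move: (m.+1%:R^-1) ta tb m1 => r ta tb m1; apply/andP; split; lra.
Qed.

Lemma cvg_expinv0 (u : nat -> R) : (forall m, m.+1%:R <= u m) ->
  expinv 0 (u m) @[m --> \oo] --> (1 : R).
Proof.
move=> um; apply: (@squeeze_cvgr _ _ _ _ (fun m => 1 - m.+1%:R^-1) (cst 1)).
- near=> m; rewrite expinv0_le1 andbT /expinv.
  have um0 : 0 < u m by rewrite (lt_le_trans _ (um m)).
  rewrite um0 expr0 invr1 mul1r; apply: le_trans (expR_ge1Dx _).
  by rewrite lerD2l lerN2 lef_pV2// posrE.
- rewrite -[X in _ --> X]subr0; apply: cvgB; first exact: cvg_cst.
  exact: cvg_harmonic.
- exact: cvg_cst.
Unshelve. all: by end_near. Qed.

Lemma cvg_boxbump a b t :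
  boxbump m a b t @[m --> \oo] --> ((a <= t <= b)%R%:R : R).
Proof.
(* Here [s] is the signed distance to an end: if negative, it eventually outweighs the margin
   1/(m+1). *)
have out (s : R) : s < 0 -> expinv 0 (m.+1%:R ^+ 2 * (s + m.+1%:R^-1)) @[m --> \oo] --> (0 : R).
  move=> s0; apply: cvg_near_cst; near=> m.
  rewrite /expinv ifF//; apply/negbTE; rewrite -leNgt.
  rewrite pmulr_rle0 ?exprn_gt0// -lerBrDl sub0r ltW//.
  near: m; have s0' : 0 < - s by rewrite oppr_gt0.
  exact: (near_infty_natSinv_lt (PosNum s0')).
(* At the ends too, where [s] is 0, the argument is at least m + 1; hence the limit is the indicator
   of the closed interval. *)
have inn (s : R) : 0 <= s -> expinv 0 (m.+1%:R ^+ 2 * (s + m.+1%:R^-1)) @[m --> \oo] --> (1 : R).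
  move=> s0; apply: cvg_expinv0 => m; rewrite mulrDr expr2 mulfK ?pnatr_eq0//.
  by rewrite lerDr mulr_ge0// mulr_ge0.
have E m : boxbump m a b t = expinv 0 (m.+1%:R ^+ 2 * (t - a + m.+1%:R^-1)) *
    expinv 0 (m.+1%:R ^+ 2 * (b - t + m.+1%:R^-1)).
  rewrite /boxbump /bump; congr (expinv _ (_ * _) * expinv _ (_ * _)); ring.
rewrite (funext E).
have [ta|ta] := leP a t; have [tb|tb] := leP t b; rewrite ?andbT ?andbF.
- by rewrite -[X in _ --> X]mulr1; apply: cvgM; apply: inn; rewrite subr_ge0.
- rewrite -[X in _ --> X](mul1r 0); apply: cvgM.
    by apply: inn; rewrite subr_ge0.
  by apply: out; rewrite subr_lt0.
- rewrite -[X in _ --> X](mul0r 1); apply: cvgM.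
    by apply: out; rewrite subr_lt0.
  by apply: inn; rewrite subr_ge0.
- by rewrite -[X in _ --> X](mul0r 0); apply: cvgM; apply: out; rewrite subr_lt0.
Unshelve. all: by end_near. Qed.

End cutoff.

Section tensor_bump.
Context {R : realType} {n : nat}.
Local Notation E := 'rV[R]_n.
Implicit Types (a b x : E).

Definition tbump (m : nat) a b : E -> R :=
  tensor (fun i => boxbump m (a ord0 i) (b ord0 i)).

Lemma tbump_ge0 m a b x : 0 <= tbump m a b x.
Proof. by apply: prodr_ge0 => i _; exact: bump_ge0. Qed.

Lemma tbump_le1 m a b x : tbump m a b x <= 1.
Proof. by apply: prodr_ile1 => i _; rewrite bump_ge0 bump_le1. Qed.

Lemma cvg_tbump a b x : tbump m a b x @[m --> \oo] --> (\1_(cbox a b) x : R).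
Proof.
have -> : \1_(cbox a b) x = \prod_(i < n) ((a ord0 i <= x ord0 i <= b ord0 i)%R%:R : R).
  rewrite indicE; have [xab|xab] := boolP (x \in cbox a b).
    by rewrite big1// => i _; move: xab; rewrite inE => /(_ i) ->.
  have /existsNP[i xi] : ~ forall i, a ord0 i <= x ord0 i <= b ord0 i.
    by move=> xab'; move: xab; rewrite notin_setE.
  by rewrite (bigD1 i)//=; move/negP/negbTE: xi => ->; rewrite mul0r.
rewrite /tbump /tensor; elim: (index_enum _) => [|i r ih].
  by under eq_fun do rewrite big_nil; rewrite big_nil; exact: cvg_cst.
under eq_fun do rewrite big_cons; rewrite big_cons.
by apply: cvgM => //; exact: cvg_boxbump.
Qed.

Lemma exists_cutoff (M : R) : exists psi : E -> R,
  test_function setT psi /\ forall x, `|x| <= M -> psi x = 1.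
Proof.
(* [M] may be nonpositive, while [exists_plateau] wants a positive half-length. *)
have L0 : 0 < Num.max M 1 by rewrite lt_max ltr01 orbT.
have [f [sf ff f1]] := exists_plateau L0.
exists (tensor (fun=> f)); split.
  apply: (@test_function_tensor _ _ _ (const_mx (- (Num.max M 1 + Num.max M 1 + 5)))
    (const_mx (Num.max M 1 + Num.max M 1 + 5))) => // i.
  by rewrite !mxE.
move=> x xM; rewrite /tensor big1// => i _; apply: f1.
rewrite -ler_norml; apply: le_trans (_ : M <= _); last by rewrite le_max lexx.
apply: le_trans xM; rewrite [leRHS]/Num.Def.normr /= mx_normrE.
by rewrite (le_bigmax _ (fun i : 'I_1 * 'I_n => `|x i.1 i.2|) (ord0, i)).
Qed.

End tensor_bump.

(** * Lebesgue measure and locally integrable functions *)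

Section boxes.
Context {R : realType} {n : nat}.
Local Notation E := 'rV[R]_n.
Local Notation mu := (@lebesgue_rV R n).
Implicit Types (a b x z : E).

Definition boxes : set (set E) := [set cbox ab.1 ab.2 | ab in [set: E * E]].

Lemma setI_closed_boxes : setI_closed boxes.
Proof.
move=> _ _ [[a b] _ <-] [[c d] _ <-].
exists (\row_i Num.max (a ord0 i) (c ord0 i), \row_i Num.min (b ord0 i) (d ord0 i)) => //=.
apply/seteqP; split => x /=.
  move=> xab; split=> i; have := xab i; rewrite !mxE ge_max le_min;
  by move=> /andP[/andP[? ?] /andP[? ?]]; apply/andP.
by move=> [xab xcd] i; rewrite !mxE ge_max le_min; have := xab i; have := xcd i;
  move=> /andP[-> ->] /andP[-> ->].
Qed.

Lemma measurable_cbox a b : measurable (cbox a b).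
Proof.
by rewrite -[cbox a b]setCK; apply: measurableC; apply: open_measurable_rV;
  apply/closed_openC/closed_cbox.
Qed.

Definition cube (k : nat) : set E := cbox (const_mx (- k%:R)) (const_mx k%:R).

Lemma cubeE k : cube k = [set x | `|x| <= k%:R].
Proof.
apply/seteqP; split => x /= xk.
  rewrite [leLHS]/Num.Def.normr /= mx_normrE; apply: bigmax_le => // -[i j] _ /=.
  by have := xk j; rewrite !mxE (ord1 i) ler_norml.
move=> i; rewrite !mxE -ler_norml; apply: le_trans xk.
rewrite [leRHS]/Num.Def.normr /= mx_normrE.
by rewrite (le_bigmax _ (fun i : 'I_1 * 'I_n => `|x i.1 i.2|) (ord0, i)).
Qed.

Lemma bigcup_cube : \bigcup_k cube k = setT.
Proof.
apply/seteqP; split => // x _; exists (Num.bound `|x|) => //.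
by rewrite cubeE /= ltW// archi_boundP.
Qed.

Lemma measurable_boxes : @measurable _ E = <<s boxes >>.
Proof.
apply/seteqP; split; last first.
  apply: smallest_sub; first exact: sigma_algebra_measurable.
  by move=> _ [ab _ <-]; exact: measurable_cbox.
apply: smallest_sub; first exact: smallest_sigma_algebra.
rewrite -bigcup_seq => B [i _ [C mC <-]] /=.
pose coord i (x : E) := x ord0 i.
have : measurable_fun setT (coord i : g_sigma_algebraType boxes -> R).
  apply: (measurability _ (RGenCInfty.measurableE R)) => //.
  move=> _ [_ [c ->] <-]; rewrite setTI.
  (* The half-space where the i-th coordinate is at least [c] is exhausted by boxes that keep this
     face fixed. *)
  rewrite (_ : _ @^-1` _ = \bigcup_k
      cbox (\row_j if j == i then c else - k%:R) (const_mx k%:R)).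
    apply: bigcupT_measurable => k; apply: sub_sigma_algebra.
    by exists (\row_j if j == i then c else - k%:R, const_mx k%:R).
  apply/seteqP; split => x /=.
    rewrite in_itv/= andbT => cx.
    have [k _ xk] : (\bigcup_k cube k) x by rewrite bigcup_cube.
    exists k => // j; rewrite !mxE; have := xk j; rewrite !mxE => /andP[k1 k2].
    by rewrite k2 andbT; case: eqP => [->|].
  move=> [k _ /(_ i)]; rewrite !mxE eqxx => /andP[cx _].
  by rewrite in_itv/= andbT.
by apply.
Qed.

Lemma lebesgue_cbox_lty a b : (mu (cbox a b) < +oo)%E.
Proof.
have [ab|/existsNP[i ab]] := pselect (forall i, a ord0 i <= b ord0 i).
  by rewrite lebesgue_rV_box// ltry.
rewrite (_ : cbox a b = set0) ?measure0//.
apply/seteqP; split => // x /(_ i) /andP[ax xb].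
by apply: ab; exact: le_trans xb.
Qed.

Lemma lebesgue_rV_sigma_finite : sigma_finite [set: E] mu.
Proof.
exists cube; first by rewrite bigcup_cube.
by move=> k; split; [exact: measurable_cbox|exact: lebesgue_cbox_lty].
Qed.

Lemma measurable_addrV z : measurable_fun setT (fun x : E => x + z).
Proof.
apply: measurable_fun_rV => i.
under eq_fun do rewrite mxE.
by apply: measurable_funD; [exact: measurable_coord|exact: measurable_cst].
Qed.

(** Uniqueness of measures: the image measure agrees with [mu] on the boxes, a generating family
    closed under intersection and containing cubes of finite measure that exhaust the space. *)
Lemma lebesgue_rV_shift z (A : set E) : measurable A -> mu ((fun x => x + z) @^-1` A) = mu A.
Proof.
pose m : {measure set E -> \bar R} :=
  [the {measure set _ -> \bar R} of pushforward mu (fun x : E => x + z)].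
move=> mA; rewrite -[LHS]/(m (measurable_addrV z) A); apply: (@measure_unique _ _ _ boxes cube) => //.
- exact: measurable_boxes.
- exact: setI_closed_boxes.
- by move=> k; exists (const_mx (- k%:R), const_mx k%:R).
- exact: bigcup_cube.
- move=> _ [[a b] _ <-] /=; rewrite /m /= /pushforward.
  rewrite (_ : _ @^-1` _ = cbox (a - z) (b - z)); last first.
    apply/seteqP; split => x /= xab i; have := xab i; rewrite !mxE.
      by rewrite lerBlDr lerBrDr.
    by rewrite lerBlDr lerBrDr.
  have [ab|/existsNP[i /negP]] := pselect (forall i, a ord0 i <= b ord0 i).
    rewrite !lebesgue_rV_box//; last by move=> i; rewrite !mxE lerD2r.
    by congr EFin; apply: eq_bigr => i _; rewrite !mxE; ring.
  (* The volume formula requires ordered corners; otherwise both boxes are empty. *)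
  rewrite -ltNge => ab; congr (mu _); apply/seteqP; split => x /(_ i).
    by rewrite !mxE => /andP[ax xb]; have := le_trans ax xb; rewrite lerD2r leNgt ab.
  by move=> /andP[ax xb]; have := le_trans ax xb; rewrite leNgt ab.
- move=> k; rewrite /m/= /pushforward.
  rewrite (_ : _ @^-1` _ = cbox (const_mx (- k%:R) - z) (const_mx k%:R - z)).
    exact: lebesgue_cbox_lty.
  apply/seteqP; split => x /= xab i; have := xab i; rewrite !mxE.
    by rewrite lerBlDr lerBrDr.
  by rewrite lerBlDr lerBrDr.
Qed.

Lemma continuous_measurable_rV (f : E -> R) : continuous f -> measurable_fun setT f.
Proof.
move=> cf; apply: (measurability _ (RGenOpens.measurableE R)) => //.
move=> _ [_ [c [d ->]] <-]; rewrite setTI; apply: open_measurable_rV.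
apply: open_comp; last exact: interval_open.
by move=> x _; exact: cf.
Qed.

End boxes.

(** * The fundamental lemma of the calculus of variations *)

Section fundamental_lemma.
Context {R : realType} {n : nat}.
Local Notation E := 'rV[R]_n.
Local Notation mu := (@lebesgue_rV R n).
Implicit Types (a b x z : E) (f : E -> R).

(** Local integrability in a form without compact sets; [L1loc_setTE] identifies it with
    [L1loc setT]. *)
Definition box_integrable f := measurable_fun setT f /\
  forall a b, mu.-integrable (cbox a b) (EFin \o f).

Lemma tbump_supported m a b x : ~ cbox (a - const_mx 1) (b + const_mx 1) x ->
  tbump m a b x = 0.
Proof.
move=> abx; apply/eqP/negPn/negP => h; apply: abx; move: h.
by apply: tensor_neq0 => i; rewrite !mxE; exact: boxbump_supported.
Qed.

Lemma smooth_tbump m a b : smooth (tbump m a b).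
Proof. by apply: smooth_tensor => i; exact: smooth1_bump. Qed.

Lemma measurable_tbump m a b : measurable_fun setT (tbump m a b).
Proof.
by apply: continuous_measurable_rV; apply: smooth_continuous; exact: smooth_tbump.
Qed.

Lemma box_integrableM f (g : E -> R) a b (M : R) : box_integrable f -> measurable_fun setT g ->
  (forall x, `|g x| <= M) -> (forall x, ~ cbox a b x -> g x = 0) ->
  mu.-integrable setT (EFin \o (fun x => f x * g x)).
Proof.
move=> [mf intf] mg gM g0.
have -> : (fun x => f x * g x) = (fun x => f x * g x) \_ (cbox a b).
  apply/funext => x; rewrite patchE; case: ifPn => // /negP; rewrite inE => /g0 ->.
  by rewrite mulr0.
rewrite -restrict_EFin; apply/integrable_restrict => //; first exact: measurable_cbox.
rewrite setTI; have := integrableZl (measurable_cbox a b) M (intf a b).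
apply: le_integrable; first exact: measurable_cbox.
  apply/measurable_EFinP; apply: measurable_funTS; exact: measurable_funM.
move=> x _ /=; rewrite lee_fin !normrM mulrC ler_wpM2r//.
by rewrite (le_trans (gM x))// ler_norm.
Qed.

Lemma box_integrable_tbump f m a b : box_integrable f ->
  mu.-integrable setT (EFin \o (fun x => f x * tbump m a b x)).
Proof.
move=> bf; apply: (@box_integrableM _ _ (a - const_mx 1) (b + const_mx 1) 1) => //.
- exact: measurable_tbump.
- by move=> x; rewrite ger0_norm ?tbump_ge0// tbump_le1.
- by move=> x; exact: tbump_supported.
Qed.

(** Dominated convergence turns the hypothesis into vanishing integrals over boxes, a Dynkin
    argument passes to Borel subsets of a cube, and a function whose integrals over all these
    subsets vanish is 0 almost everywhere on the cube. *)
Lemma fundamental_lemma f : box_integrable f ->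
  (forall m a b, \int[mu]_x (f x * tbump m a b x) = 0) ->
  {ae mu, forall x, f x = 0}.
Proof.
move=> bf f0; have [mf intf] := bf.
have box0 a b : (\int[mu]_(x in cbox a b) (f x)%:E = 0)%E.
  pose D := cbox (a - const_mx 1) (b + const_mx 1).
  have mD : measurable D by exact: measurable_cbox.
  have cvgf x : (f x * tbump m a b x)%:E @[m --> \oo] --> (((EFin \o f) \_ (cbox a b)) x).
    have -> : ((EFin \o f) \_ (cbox a b)) x = (f x * \1_(cbox a b) x)%:E.
      by rewrite patchE indicE; case: ifPn => _; rewrite ?mulr1 ?mulr0.
    apply: cvg_EFin; first exact: nearW.
    apply: cvgM; [exact: cvg_cst|exact: cvg_tbump].
  have mF m : measurable_fun setT (fun x => (f x * tbump m a b x)%:E).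
    exact: measurable_int (box_integrable_tbump m a b bf).
  have mFb : measurable_fun setT ((EFin \o f) \_ (cbox a b)).
    apply/(measurable_restrictT _ (measurable_cbox _ _)).
    exact/measurable_EFinP/measurable_funTS.
  (* All bumps live in the box enlarged by 1, because the margin 1/(m+1) is at most 1, and they are
     bounded by 1. *)
  have iD : mu.-integrable setT (fun x => `|((EFin \o f) \_ D) x|%E).
    by apply: integrable_abse; apply/integrable_restrict => //; rewrite setTI; exact: intf.
  have dom : {ae mu, forall x m, setT x ->
      (`|(f x * tbump m a b x)%:E| <= `|((EFin \o f) \_ D) x|)%E}.
    apply: nearW => x m _; rewrite patchE; case: ifPn => [_|/negP].
      by rewrite /= lee_fin normrM ler_piMr// ger0_norm ?tbump_ge0// tbump_le1.
    by rewrite inE => /tbump_supported ->; rewrite mulr0.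
  have [_ _] := @dominated_convergence _ _ _ mu setT measurableT _ _ _ mF mFb
    (nearW _ (fun x _ => cvgf x)) iD dom.
  rewrite -integral_mkcond => h; apply: (cvg_unique _ h) => //.
  rewrite (_ : (fun _ => _) = cst 0%E); first exact: cvg_cst.
  apply/funext => m; have := f0 m a b; rewrite /Rintegral.
  rewrite /= => E0; rewrite -[LHS]fineK ?E0//.
  exact: (integrable_fin_num _ (box_integrable_tbump m a b bf)).
(* [f] is integrable on a cube but perhaps not globally, so the induction on complements and
   countable unions stays inside one cube. *)
have cube0 k A : measurable A -> (\int[mu]_(x in A `&` cube k) (f x)%:E = 0)%E.
  have mk : measurable (@cube R n k) by exact: measurable_cbox.
  have ik : mu.-integrable (cube k) (EFin \o f) by exact: intf.
  rewrite measurable_boxes => sA.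
  apply: (@dynkin_induction _ E boxes (fun A => \int[mu]_(x in A `&` cube k) (f x)%:E = 0)%E) => //.
  - exact: measurable_boxes.
  - exact: setI_closed_boxes.
  - by rewrite setTI box0.
  - move=> _ [[a b] _ <-] /=.
    have [[c d] _ <-] := setI_closed_boxes (ex_intro2 _ _ (a, b) I erefl)
      (ex_intro2 _ _ (const_mx (- k%:R), const_mx k%:R) I erefl : boxes (cube k)).
    exact: box0.
  - move=> S mS S0; have := box0 (const_mx (- k%:R)) (const_mx k%:R).
    rewrite -/(cube k) -{1}(setUIDK (cube k) S) integral_setU//.
    + by rewrite (setIC (cube k) S) S0 add0e setDE setIC.
    + exact: measurableI.
    + exact: measurableD.
    + rewrite setUIDK; exact: (measurable_int _ ik).
    + rewrite disj_set2E; apply/eqP/seteqP; split => // x [[_ Sx] [_]]//.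
  - move=> F mF tF F0; rewrite setI_bigcupl integral_bigcup//.
    + by rewrite eseries0// => i _ _; rewrite F0.
    + exact: trivIset_setIr.
    + by move=> i; exact: measurableI.
    + apply: integrableS ik => //; first by apply: bigcupT_measurable => i; exact: measurableI.
      by move=> x [i _ []].
have ae0 k : ae_eq mu (cube k) (EFin \o f) (cst 0%E).
  apply: integral_ae_eq => //; [exact: measurable_cbox|exact: intf|].
  move=> A Ak mA; rewrite integral0.
  by have := cube0 k A mA; rewrite (_ : A `&` cube k = A)//; exact/setIidPl.
have := ae_foralln ae0; apply: filterS => x xk.
have [k _ kx] : (\bigcup_k cube k) x by rewrite bigcup_cube.
by have /= := xk k kx; case.
Qed.

End fundamental_lemma.

(** * Test functions and weak gradients on the whole space *)

Section weak_gradient_setT.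
Context {R : realType} {n : nat}.
Local Notation E := 'rV[R]_n.
Local Notation mu := (@lebesgue_rV R n).
Implicit Types (a b x z : E) (u f phi : E -> R) (g : E -> E).

Lemma compact_sub_cube (K : set E) : compact K -> exists k : nat, K `<=` cube k.
Proof.
move=> /compact_bounded[M [_ KM]].
exists (Num.bound (`|M| + 1)) => x Kx; rewrite cubeE /=.
apply: le_trans (_ : `|M| + 1 <= _).
  by apply: KM => //; rewrite (le_lt_trans (ler_norm M))// ltrDl.
by rewrite ltW// archi_boundP// addr_ge0.
Qed.

Lemma L1loc_setTE u : L1loc setT u <-> box_integrable u.
Proof.
split=> -[mu_ iu]; split => //.
  by move=> a b; apply: iu => //; exact: compact_cbox.
move=> K cK _; have [k Kk] := compact_sub_cube cK.
apply: (integrableS (measurable_cbox (const_mx (- k%:R)) (const_mx k%:R))) => //.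
rewrite -[K]setCK; apply: measurableC; apply: open_measurable_rV.
by apply/closed_openC; apply: compact_closed => //; exact: norm_hausdorff.
Qed.

Lemma test_function_smooth phi : test_function setT phi -> smooth phi.
Proof. by case. Qed.

Lemma test_function_cube phi : test_function setT phi ->
  exists k : nat, forall x, ~ cube k x -> phi x = 0.
Proof.
move=> [_ cphi _]; have [k hk] := compact_sub_cube cphi.
exists k => x xk; apply/eqP/negPn/negP => phix; apply: xk; apply: hk.
exact: subset_closure.
Qed.

Lemma test_function_bounded phi : test_function setT phi ->
  exists M : R, forall x, `|phi x| <= M.
Proof.
move=> tphi; have [k phik] := test_function_cube tphi.
have cphi := smooth_continuous (test_function_smooth tphi).
have /compact_bounded[M [_ KM]] : compact (phi @` cube k).
  apply: continuous_compact; last exact: compact_cbox.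
  exact: continuous_subspaceT.
exists (`|M| + 1) => x; have [kx|/phik ->] := pselect (cube k x); last first.
  by rewrite normr0 addr_ge0.
by apply: KM; [rewrite (le_lt_trans (ler_norm M))// ltrDl|exists x].
Qed.

Lemma test_function_partial i phi : test_function setT phi ->
  test_function setT (partial i phi).
Proof.
move=> [sphi cphi _]; split => //; first exact: smooth_partial.
apply: subclosed_compact cphi _; first exact: closed_closure.
rewrite [X in _ `<=` X](closure_id _).1; last exact: closed_closure.
apply: closure_subset => x /=.
apply: contra_neqP => /= xphi.
(* Off its closed support [phi] vanishes on a neighbourhood, hence so does its derivative. *)
have : \forall y \near x, cst 0 y = phi y.
  have : open (~` closure [set y | phi y != 0]) by exact/closed_openC/closed_closure.
  rewrite openE => /(_ _ xphi); apply: filterS => y yphi.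
  by apply/esym/eqP/negPn/negP => phiy; apply: yphi; exact: subset_closure.
by move=> /near_eq_derive h; rewrite /partial -h derive_cst.
Qed.

Lemma test_functionM phi psi : smooth psi -> test_function setT phi ->
  test_function setT (fun x => psi x * phi x).
Proof.
move=> spsi [sphi cphi _]; split => //.
  by apply: smoothnE; apply: smoothnM; exact: smoothn_smooth.
apply: subclosed_compact cphi _; first exact: closed_closure.
by apply: closure_subset => x /=; rewrite mulf_eq0 negb_or => /andP[].
Qed.

Lemma test_function_integrable u phi : box_integrable u -> test_function setT phi ->
  mu.-integrable setT (EFin \o (fun x => u x * phi x)).
Proof.
move=> bu tphi; have [k phik] := test_function_cube tphi.
have [M phiM] := test_function_bounded tphi.
apply: (@box_integrableM _ _ _ _ (const_mx (- k%:R)) (const_mx k%:R) M) => //.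
by apply: continuous_measurable_rV; apply: smooth_continuous; exact: test_function_smooth.
Qed.

Lemma test_function_tbump m a b : test_function setT (tbump m a b).
Proof.
apply: (@test_function_tensor _ _ _ (a - const_mx 1) (b + const_mx 1)) => i.
  exact: smooth1_bump.
by rewrite !mxE; exact: boxbump_supported.
Qed.

Lemma box_integrableB u v : box_integrable u -> box_integrable v ->
  box_integrable (fun x => u x - v x).
Proof.
move=> [mu_ iu] [mv iv]; split; first exact: measurable_funB.
by move=> a b; have := integrableB (measurable_cbox a b) (iu a b) (iv a b).
Qed.

(** Reduction to [ae_foralln]: a natural number that is not an index imposes no condition. *)
Lemma ae_forall_ord (P : 'I_n -> E -> Prop) :
  (forall i, {ae mu, forall x, P i x}) -> {ae mu, forall x i, P i x}.
Proof.
move=> aeP; pose Q (m : nat) x := forall i : 'I_n, i = m :> nat -> P i x.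
have : forall m, {ae mu, forall x, Q m x}.
  move=> m; have [mn|nm] := ltnP m n.
    apply: filterS (aeP (Ordinal mn)) => x Px i im.
    by rewrite (_ : i = Ordinal mn)//; exact/val_inj.
  by apply: nearW => x i im; have := ltn_ord i; rewrite im ltnNge nm.
by move=> /ae_foralln; apply: filterS => x Qx i; exact: (Qx i i erefl).
Qed.

(** Allows an explicit weak gradient in place of the one that [grad] picks. The difference of two
    weak gradients integrates to 0 against every test function, in each coordinate. *)
Lemma weak_gradient_ae_eq u g g' : weak_gradient setT u g ->
  weak_gradient setT u g' -> {ae mu, forall x, g x = g' x}.
Proof.
move=> ug ug'.
suff : {ae mu, forall x i, g x ord0 i - g' x ord0 i = 0}.
  apply: filterS => x gx; apply/rowP => i; apply/eqP.
  by rewrite -subr_eq0 gx.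
apply: ae_forall_ord => i.
have [/L1loc_setTE gi ui] := ug i; have [/L1loc_setTE gi' ui'] := ug' i.
apply: fundamental_lemma; first exact: box_integrableB.
move=> m a b; have tb := test_function_tbump m a b.
under eq_Rintegral do rewrite mulrBl.
rewrite RintegralB//; [|exact: test_function_integrable|exact: test_function_integrable].
by rewrite -[X in X - _]opprK -ui// -[X in _ - X]opprK -ui'// subrr.
Qed.

Lemma integral_shift z (f : E -> \bar R) : measurable_fun setT f ->
  (\int[mu]_x f (x + z)%R = \int[mu]_x f x)%E.
Proof.
move=> mf.
have H (h : E -> \bar R) : measurable_fun setT h -> (forall x, 0 <= h x)%E ->
    (\int[mu]_x h (x + z)%R = \int[mu]_x h x)%E.
  move=> mh h0.
  have := ge0_integral_pushforward (measurable_addrV z) mu measurableT mh (fun x _ => h0 x).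
  rewrite preimage_setT => <-.
  apply: eq_measure_integral; first exact: measurable_addrV.
  by move=> mz A mA _; exact: lebesgue_rV_shift.
rewrite integralE [RHS]integralE; congr (_ - _)%E.
  rewrite -(H _ (measurable_funepos mf) (funepos_ge0 f)).
  by apply: eq_integral => x _; rewrite !funeposE.
rewrite -(H _ (measurable_funeneg mf) (funeneg_ge0 f)).
by apply: eq_integral => x _; rewrite !funenegE.
Qed.

Lemma Rintegral_shift z f : measurable_fun setT f ->
  \int[mu]_x f (x + z) = \int[mu]_x f x.
Proof.
move=> mf; congr fine; apply: (@integral_shift z (EFin \o f)).
exact/measurable_EFinP.
Qed.

Lemma ae_shift z (P : E -> Prop) : {ae mu, forall x, P x} -> {ae mu, forall x, P (x + z)}.
Proof.
move=> [N [mN N0 PN]]; exists ((fun x => x + z) @^-1` N); split.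
- by rewrite -[X in measurable X]setTI; exact: measurable_addrV.
- by rewrite lebesgue_rV_shift.
- by move=> x /= Px; exact: PN.
Qed.

End weak_gradient_setT.

(** * Difference quotients of weakly differentiable functions *)

Section sigma_finite_alias.
Context {R : realType} {n : nat}.

(* A copy of [lebesgue_rV n], whose head symbol can carry the sigma-finite
   structure that the Fubini theorems require. *)
Definition lebesgue_sf : set 'rV[R]_n -> \bar R := lebesgue_rV n.

HB.instance Definition _ := isMeasure.Build _ _ _ lebesgue_sf
  (measure0 (lebesgue_rV n)) (measure_ge0 (lebesgue_rV n))
  (@measure_semi_sigma_additive _ _ _ (lebesgue_rV n)).

HB.instance Definition _ := @Measure_isSigmaFinite.Build _ _ _ lebesgue_sf
  (@lebesgue_rV_sigma_finite R n).

End sigma_finite_alias.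

(** * Fubini for averages over the unit interval *)

Section fubini_unit_interval.
Context {R : realType} {n : nat}.
Local Notation E := 'rV[R]_n.
Local Notation mu := (@lebesgue_rV R n).
Local Notation TR := (measurableTypeR R).

Definition unif01 : probability TR R := uniform_prob (@ltr01 R).
Local Notation nu := unif01.
Local Notation mus := (@lebesgue_sf R n).

Lemma unif01_setT : nu setT = 1%E.
Proof. exact: probability_setT. Qed.

Lemma tonelli01 (f : E * TR -> \bar R) : measurable_fun setT f ->
  (forall xs, 0 <= f xs)%E ->
  (\int[mu]_x \int[nu]_s f (x, s) = \int[nu]_s \int[mu]_x f (x, s))%E.
Proof. by move=> mf f0; exact: (@fubini_tonelli _ _ _ _ _ mus nu f). Qed.

Lemma integrable01P (f : E * TR -> R) : measurable_fun setT f ->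
  (\int[nu]_s \int[mu]_x `|(f (x, s))%:E| < +oo)%E ->
  (mus \x nu)%E.-integrable setT (EFin \o f).
Proof.
by move=> mf h; apply/(@integrable21ltyP _ _ _ _ _ mus nu) => //; exact/measurable_EFinP.
Qed.

Lemma integrable_fubini01 (f : E * TR -> R) :
  (mus \x nu)%E.-integrable setT (EFin \o f) ->
  mu.-integrable setT (EFin \o (fun x => \int[nu]_s f (x, s))).
Proof.
move=> intf; have intF := integrable_fubini_F intf.
have mF := measurable_int _ intF.
apply: (le_integrable _ _ _ intF) => //.
  apply/measurable_EFinP; exact: (measurableT_comp (fine_measurable measurableT) mF).
(* [fine] sends infinite values to 0, which does not increase absolute values. *)
by move=> x _; rewrite /fubini_F /Rintegral /=; case: (integral _ _ _) => [r| |] //=;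
  rewrite normr0 ?leey.
Qed.

(** The inner real integrals are [fine] of extended ones and agree with them only where these are
    finite. Integrability of the partial integrals gives this almost everywhere, which suffices for
    the outer integral. *)
Lemma fubini01 (f : E * TR -> R) :
  (mus \x nu)%E.-integrable setT (EFin \o f) ->
  \int[mu]_x \int[nu]_s f (x, s) = \int[nu]_s \int[mu]_x f (x, s).
Proof.
move=> intf; have intF := integrable_fubini_F intf; have mf := measurable_int _ intf.
have intG : nu.-integrable setT (fubini_G mus (EFin \o f)).
  apply/integrableP; split; first exact: (measurable_fubini_G intf).
  apply: le_lt_trans ((integrable21ltyP _ _ mf).1 intf).
  apply: ge0_le_integral => //.
  - by apply: measurableT_comp => //; exact: (measurable_fubini_G intf).
  - apply: (@measurable_fun_fubini_tonelli_G _ _ _ _ _ mus (abse \o (EFin \o f))) => //=.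
    exact: measurableT_comp.
  - move=> s _; apply: le_abse_integral => //.
    exact: (measurableT_comp mf (measurable_pair2 s)).
have H := @Fubini _ _ _ _ _ mus nu _ intf.
rewrite /Rintegral -[in LHS]/mus; congr fine.
transitivity (\int[mus]_x \int[nu]_s (f (x, s))%:E)%E.
  apply: ae_eq_integral => //.
  - exact: (measurable_int _ (integrable_fubini01 intf)).
  - exact: (measurable_int _ intF).
  - apply: filterS (integrable_ae measurableT intF) => x /(_ I) xfin _.
    by rewrite /= fineK.
rewrite H; apply: ae_eq_integral => //.
- exact: (measurable_int _ intG).
- apply/measurable_EFinP; exact: (measurableT_comp (fine_measurable measurableT) (measurable_int _ intG)).
- apply: filterS (integrable_ae measurableT intG) => x /(_ I) xfin _.
  by rewrite /= fineK.
Qed.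

End fubini_unit_interval.

Section difference_quotient.
Context {R : realType} {n : nat}.
Local Notation E := 'rV[R]_n.
Local Notation mu := (@lebesgue_rV R n).
Local Notation TR := (measurableTypeR R).
Local Notation nu := (@unif01 R).
Local Notation mus := (@lebesgue_sf R n).
Implicit Types (a b x z : E) (u v f phi G : E -> R) (h s : R) (i : 'I_n).

(* Since [unif01] is a measure on all of R, clamping makes the bound [|h|] on the
   length of the translations in [along] hold everywhere, and not just for
   almost every parameter. *)
Definition clamp01 s : R := Num.max 0 (Num.min s 1).

Lemma clamp01_ge0 s : 0 <= clamp01 s.
Proof. by rewrite le_max lexx. Qed.

Lemma clamp01_le1 s : clamp01 s <= 1.
Proof. by rewrite ge_max ler01/= ge_min lexx orbT. Qed.

Lemma clamp01_id s : 0 <= s <= 1 -> clamp01 s = s.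
Proof. by move=> /andP[s0 s1]; rewrite /clamp01 (min_idPl s1) (max_idPr s0). Qed.

Lemma measurable_clamp01 : measurable_fun setT clamp01.
Proof.
apply: measurable_maxr => //; apply: measurable_minr => //.
Qed.

Definition along i h x s : E := x + (clamp01 s * h) *: delta_mx ord0 i.

(** The mean over the segment from x to x + h e_i: [h * avg i h G x] is the line integral of [G],
    with the right sign also for negative [h]. *)
Definition avg i h G x : R := \int[nu]_s G (along i h x s).

Lemma measurable_along i h : measurable_fun setT (fun xs : E * TR => along i h xs.1 xs.2).
Proof.
apply: measurable_fun_rV => j; under eq_fun do rewrite !mxE.
apply: measurable_funD.
  exact: (measurableT_comp (measurable_coord j)).
apply: measurable_funM => //; apply: measurable_funM => //.
exact: (measurableT_comp measurable_clamp01).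
Qed.

Lemma along_coord i h x s j :
  along i h x s ord0 j = x ord0 j + (if j == i then clamp01 s * h else 0).
Proof. by rewrite !mxE eqxx/=; case: eqP; rewrite ?mulr1 ?mulr0. Qed.

Lemma clamp01M_le s h : `|clamp01 s * h| <= `|h|.
Proof. by rewrite normrM ler_piMl// ger0_norm ?clamp01_ge0// clamp01_le1. Qed.

Lemma along_cbox i h a b x s : cbox a b x ->
  cbox (a - const_mx `|h|) (b + const_mx `|h|) (along i h x s).
Proof.
move=> abx j; rewrite along_coord !mxE; have := abx j.
have := clamp01M_le s h; rewrite ler_norml; have := normr_ge0 h.
by case: ifPn => _ h0 /andP[h1 h2] /andP[h3 h4]; apply/andP; split; lra.
Qed.

Lemma integrable01_bounded (H : E * TR -> R) (C : R) : measurable_fun setT H ->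
  (forall s, \int[mu]_x `|(H (x, s))%:E| <= C%:E)%E ->
  (mus \x nu)%E.-integrable setT (EFin \o H).
Proof.
move=> mH HC; apply: integrable01P => //.
apply: (@le_lt_trans _ _ (\int[nu]_s C%:E)%E); last first.
  by rewrite integral_cst// [X in (_ * X)%E]unif01_setT mule1 ltry.
apply: ge0_le_integral => //.
- by move=> s _; exact: integral_ge0.
- apply: (@measurable_fun_fubini_tonelli_G _ _ _ _ _ mus
    (fun xs : E * TR => `|(H xs)%:E|%E)) => //.
  by apply: measurableT_comp => //; exact/measurable_EFinP.
Qed.

(** For each fixed parameter [along] is a translation, so the integral of the absolute value is at
    most that of |G|, uniformly in the parameter. *)
Lemma integrable_along i h G phi : mu.-integrable setT (EFin \o G) ->
  measurable_fun setT phi -> (forall x, `|phi x| <= 1) ->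
  (mus \x nu)%E.-integrable setT
    (EFin \o (fun xs : E * TR => G (along i h xs.1 xs.2) * phi xs.1)).
Proof.
move=> iG mphi phi1.
have mG : measurable_fun setT G by apply/measurable_EFinP; exact: measurable_int iG.
have mf : measurable_fun setT (fun xs : E * TR => G (along i h xs.1 xs.2) * phi xs.1).
  apply: measurable_funM; last exact: (measurableT_comp mphi).
  exact: (measurableT_comp mG (measurable_along i h)).
have /integrableP[_ iGoo] := iG.
apply: (@integrable01_bounded _ (fine (\int[mu]_x `|(G x)%:E|)%E)) => // s.
rewrite fineK; last by rewrite ge0_fin_numE// integral_ge0.
rewrite -(@integral_shift _ _ ((clamp01 s * h) *: delta_mx ord0 i)
  (fun x => `|(G x)%:E|%E)); last by do 2 apply: measurableT_comp => //.
apply: ge0_le_integral => //.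
- apply: measurableT_comp => //; apply/measurable_EFinP.
  exact: (measurableT_comp mf (measurable_pair2 s)).
- do 2 apply: measurableT_comp => //; apply: measurableT_comp => //.
  exact: measurable_addrV.
- by move=> x _; rewrite lee_fin normrM ler_piMr.
Qed.

Lemma restrict_box_integrable G a b : box_integrable G ->
  mu.-integrable setT (EFin \o (G \_ (cbox a b))).
Proof.
move=> [mG iG]; rewrite -restrict_EFin; apply/integrable_restrict => //.
  exact: measurable_cbox.
by rewrite setTI.
Qed.

(** Lets a locally integrable [G] be replaced by an integrable one, as Fubini on the whole space
    requires: segments starting in a box stay in the box enlarged by |h|. *)
Lemma avg_restrict i h G a b x : cbox a b x ->
  avg i h G x = avg i h (G \_ (cbox (a - const_mx `|h|) (b + const_mx `|h|))) x.
Proof.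
move=> abx; apply: eq_Rintegral => s _; rewrite patchE mem_set//.
exact: along_cbox.
Qed.

Lemma integrable_avg i h G : mu.-integrable setT (EFin \o G) ->
  mu.-integrable setT (EFin \o avg i h G).
Proof.
move=> iG; have c1 (x : E) : `|cst (1:R) x| <= 1 by rewrite normr1.
have := integrable_fubini01 (integrable_along i h iG (measurable_cst _) c1).
by congr (integrable _ _ _); apply/funext => x; congr EFin;
  apply: eq_Rintegral => s _; rewrite mulr1.
Qed.

Lemma box_integrable_avg i h G : box_integrable G -> box_integrable (avg i h G).
Proof.
move=> bG.
have ibox a b : mu.-integrable (cbox a b) (EFin \o avg i h G).
  have iW := restrict_box_integrable (a - const_mx `|h|) (b + const_mx `|h|) bG.
  have := integrableS measurableT (measurable_cbox a b) (@subsetT _ _) (integrable_avg i h iW).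
  apply: eq_integrable; first exact: measurable_cbox.
  by move=> x; rewrite inE => /avg_restrict /= <-.
split => //.
rewrite -(@bigcup_cube R n); apply/measurable_fun_bigcup.
  by move=> k; exact: measurable_cbox.
by move=> k; apply/measurable_EFinP; exact: measurable_int (ibox _ _).
Qed.

Lemma box_integrable_shift z v : box_integrable v -> box_integrable (fun x => v (x + z)).
Proof.
move=> [mv iv]; have mvz : measurable_fun setT (fun x => v (x + z)).
  by apply: measurableT_comp => //; exact: measurable_addrV.
split => // a b; have /integrableP[_ h] := iv (a + z) (b + z).
apply/integrableP; split; first exact/measurable_EFinP/measurable_funTS.
apply: le_lt_trans h; rewrite integral_mkcond [leRHS]integral_mkcond.
rewrite -[leRHS](integral_shift z)//; last first.
  apply/(measurable_restrictT _ (measurable_cbox _ _)).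
  by do 2 apply: measurableT_comp => //; exact: measurable_funTS.
rewrite le_eqVlt; apply/orP; left; apply/eqP; apply: eq_integral => x _.
rewrite !patchE; suff -> : (x \in cbox a b) = (x + z \in cbox (a + z) (b + z)) by [].
by apply/idP/idP; rewrite !in_setE => xab i; have := xab i; rewrite !mxE !lerD2r.
Qed.

End difference_quotient.

Section difference_quotient_formula.
Context {R : realType} {n : nat}.
Local Notation E := 'rV[R]_n.
Local Notation leb := (@lebesgue_measure R).
Local Notation nu := (@unif01 R).
Implicit Types (a b x z : E) (u v f phi G : E -> R) (h s t : R) (i : 'I_n).

Lemma Rintegral_unif01 (f : R -> R) : continuous f -> (forall s, 0 <= f s) ->
  \int[nu]_s f (clamp01 s) = \int[leb]_(s in `[0, 1]) f s.
Proof.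
move=> cf f0; rewrite /Rintegral; congr fine.
rewrite (@integral_uniform _ _ _ ltr01 (fun s => (f (clamp01 s))%:E)) //.
- rewrite subr0 invr1 mul1e; apply: eq_integral => s.
  by rewrite inE/= in_itv/= => s01; rewrite clamp01_id.
- apply/measurable_EFinP; apply: measurableT_comp; last exact: measurable_clamp01.
  exact: continuous_measurable_fun.
- by move=> s; rewrite lee_fin.
Qed.

Lemma Rintegral_FTC2 (f F : R -> R) : continuous f ->
  (forall s, is_derive s 1 F (f s)) -> \int[leb]_(s in `[0, 1]) f s = F 1 - F 0.
Proof.
move=> cf dF; rewrite /Rintegral (@continuous_FTC2 _ f F)//.
- exact: continuous_subspaceT.
- have cF : continuous F.
    move=> s; apply: differentiable_continuous; apply/derivable1_diffP.
    by case: (dF s).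
  split.
  + by move=> s _; case: (dF s).
  + by apply: cvg_at_right_filter; exact: cF.
  + by apply: cvg_at_left_filter; exact: cF.
- by move=> s _; have [_] := dF s; rewrite derive1E.
Qed.

(** The fundamental theorem of calculus for s -> F(t - s h), whose derivative is -h f(t - s h); the
    sign of [h] does not matter. *)
Lemma Rintegral_unif01_shift (f F : R -> R) t h : continuous f ->
  (forall s, 0 <= f s) -> (forall s, is_derive s 1 F (f s)) ->
  h * \int[nu]_s f (t - clamp01 s * h) = F t - F (t - h).
Proof.
move=> cf f0 dF.
have dA s : is_derive s 1 (fun s : R => - h * s + t) (- h) by exact: is_derive_affine.
have cA : continuous (fun s : R => - h * s + t).
  move=> s; apply: differentiable_continuous; apply/derivable1_diffP.
  by case: (dA s).
have cfA : continuous (fun s : R => f (- h * s + t)).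
  by move=> s; apply: continuous_comp; [exact: cA|exact: cf].
have -> : \int[nu]_s f (t - clamp01 s * h) = \int[nu]_s f (- h * clamp01 s + t).
  by apply: eq_Rintegral => s _; congr f; ring.
rewrite (@Rintegral_unif01 (fun s => f (- h * s + t)))//.
have ifA : leb.-integrable `[0, 1] (EFin \o (fun s : R => f (- h * s + t))).
  apply: continuous_compact_integrable; first exact: segment_compact.
  exact: continuous_subspaceT.
rewrite -[LHS]opprK -mulNr -RintegralZl//.
have dFA s : is_derive s 1 (F \o (fun s : R => - h * s + t)) (- h * f (- h * s + t)).
  by rewrite mulrC; apply: is_derive1_comp.
rewrite (Rintegral_FTC2 _ dFA) /=; last first.
  by move=> s; apply: cvgM; [exact: cvg_cst|exact: cfA].
by rewrite mulr1 mulr0 add0r opprB addrC (addrC t) addrC.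
Qed.

Lemma tensor_along i (f : 'I_n -> R -> R) x y :
  tensor f (x + y *: delta_mx ord0 i) =
  f i (x ord0 i + y) * \prod_(j < n | j != i) f j (x ord0 j).
Proof.
rewrite /tensor (bigD1 i)//= !mxE !eqxx mulr1; congr (_ * _).
by apply: eq_bigr => j ji; rewrite !mxE (negbTE ji) andbF mulr0 addr0.
Qed.

(* Testing the weak gradient of [v] against it produces a translation difference
   of [v], see [partial_bump_primitive]. *)
Definition bump_primitive m a b h i : 'I_n -> R -> R :=
  fun j => if j == i then
    fun t => primitive (boxbump m (a ord0 i) (b ord0 i)) (t + - h) -
             primitive (boxbump m (a ord0 i) (b ord0 i)) (t + 0)
  else boxbump m (a ord0 j) (b ord0 j).

Lemma smooth1_boxbump m (c d : R) : smooth1 (boxbump m c d).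
Proof. exact: smooth1_bump. Qed.

Lemma bump_primitive_supported m a b h i j :
  supported (bump_primitive m a b h i j)
    ((a - const_mx (1 + `|h|)) ord0 j) ((b + const_mx (1 + `|h|)) ord0 j).
Proof.
rewrite /bump_primitive !mxE; have h0 := normr_ge0 h; case: eqP => [->|_] t.
  move=> /(supported_primitiveB (smooth1_continuous (smooth1_boxbump _ _ _))
    (@boxbump_supported _ m (a ord0 i) (b ord0 i))).
  by rewrite normrN normr0 addr0 => /andP[]; lra.
by move=> /boxbump_supported/andP[]; lra.
Qed.

Lemma test_function_bump_primitive m a b h i :
  test_function setT (tensor (bump_primitive m a b h i)).
Proof.
apply: test_function_tensor => [j|j]; last exact: bump_primitive_supported.
rewrite /bump_primitive; case: ifPn => _; last exact: smooth1_boxbump.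
exact: (smooth1_primitiveB _ _ (smooth1_boxbump _ _ _) (@boxbump_supported _ _ _ _)).
Qed.

Lemma partial_bump_primitive m a b h i x :
  partial i (tensor (bump_primitive m a b h i)) x =
  tbump m a b (x + - h *: delta_mx ord0 i) - tbump m a b x.
Proof.
set B := boxbump m (a ord0 i) (b ord0 i).
have dF t : is_derive t 1 (primitive B) (B t).
  exact: (is_derive_primitive _ (smooth1_continuous (smooth1_boxbump _ _ _)) (@boxbump_supported _ _ _ _)).
have dP t : is_derive t 1 (bump_primitive m a b h i i) (B (t + - h) - B (t + 0)).
  rewrite /bump_primitive eqxx -/B.
  have dS c : is_derive t 1 (fun s : R => s + c) (1:R).
    rewrite (_ : (fun _ => _) = fun s : R => 1 * s + c); first exact: is_derive_affine.
    by apply/funext => s; rewrite mul1r.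
  have d1 := @is_derive1_comp _ (primitive B) (+%R^~ (- h)) t _ _ (dF (t + - h)) (dS (- h)).
  have d2 := @is_derive1_comp _ (primitive B) (+%R^~ 0) t _ _ (dF (t + 0)) (dS 0).
  by have := is_deriveB d1 d2; rewrite !mulr1.
rewrite (partial_tensor _ dP) {1}/tbump tensor_along.
rewrite /tbump /tensor [in LHS](bigD1 i)//= [in X in _ - X](bigD1 i)//= eqxx addr0.
rewrite -/B mulrBl; congr (_ * _ - _ * _); apply: eq_bigr => j /negbTE ji;
  by rewrite /bump_primitive ji.
Qed.

(** The backward segment average of a bump is expressed by the very function whose i-th derivative
    is computed in [partial_bump_primitive]; this coincidence is what makes the duality argument
    close. *)
Lemma avg_tbump m a b h i x :
  h * \int[nu]_s tbump m a b (x - (clamp01 s * h) *: delta_mx ord0 i) =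
  - tensor (bump_primitive m a b h i) x.
Proof.
set B := boxbump m (a ord0 i) (b ord0 i).
set K := \prod_(j < n | j != i) boxbump m (a ord0 j) (b ord0 j) (x ord0 j).
have cB : continuous B by exact/smooth1_continuous/smooth1_boxbump.
have dF t : is_derive t 1 (primitive B) (B t).
  exact: (is_derive_primitive _ cB (@boxbump_supported _ _ _ _)).
under eq_Rintegral do rewrite -scaleNr /tbump tensor_along -/B -/K.
rewrite RintegralZr//; last first.
    have i1 : nu.-integrable setT (EFin \o cst (1:R)) by exact: finite_measure_integrable_cst.
  apply: (le_integrable measurableT _ _ i1) => //.
    apply/measurable_EFinP.
    apply: (measurableT_comp (continuous_measurable_fun cB)).
    apply: measurable_funD => //; apply: measurable_funN => //.
    by apply: measurable_funM => //; exact: measurable_clamp01.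
  by move=> s _; rewrite lee_fin normr1 ger0_norm ?bump_ge0 ?bump_le1.
rewrite mulrA (Rintegral_unif01_shift _ _ cB _ dF); last by move=> s; exact: bump_ge0.
rewrite /tensor (bigD1 i)//= {1}/bump_primitive eqxx -/B addr0 -mulNr opprB.
congr (_ * _); apply: eq_bigr => j /negbTE ji.
by rewrite /bump_primitive ji.
Qed.

End difference_quotient_formula.

Section weak_difference_quotient.
Context {R : realType} {n : nat}.
Local Notation E := 'rV[R]_n.
Local Notation mu := (@lebesgue_rV R n).
Local Notation TR := (measurableTypeR R).
Local Notation nu := (@unif01 R).
Local Notation mus := (@lebesgue_sf R n).
Implicit Types (a b x z : E) (u v f phi psi G : E -> R) (h s t : R) (i : 'I_n).

Lemma measurable_along_opp i h psi : measurable_fun setT psi ->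
  measurable_fun setT
    (fun xs : E * TR => psi (xs.1 - (clamp01 xs.2 * h) *: delta_mx ord0 i)).
Proof.
move=> mpsi; have := measurableT_comp mpsi (measurable_along i (- h)).
by congr (measurable_fun _ _); apply/funext => s; rewrite /= /along mulrN scaleNr.
Qed.

Lemma integrable_along_opp i h psi x : measurable_fun setT psi ->
  (forall x, `|psi x| <= 1) ->
  nu.-integrable setT
    (EFin \o (fun s => psi (x - (clamp01 s * h) *: delta_mx ord0 i))).
Proof.
move=> mpsi psi1.
have i1 : nu.-integrable setT (EFin \o cst (1:R)) by exact: finite_measure_integrable_cst.
apply: (le_integrable measurableT _ _ i1) => //.
  apply/measurable_EFinP.
  exact: (measurableT_comp (measurable_along_opp i h mpsi) (measurable_pair1 x)).
by move=> s _; rewrite lee_fin normr1.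
Qed.

Lemma integrableM_along_opp i h G psi : mu.-integrable setT (EFin \o G) ->
  measurable_fun setT psi -> (forall x, `|psi x| <= 1) ->
  (mus \x nu)%E.-integrable setT (EFin \o (fun xs : E * TR =>
    G xs.1 * psi (xs.1 - (clamp01 xs.2 * h) *: delta_mx ord0 i))).
Proof.
move=> iG mpsi psi1.
have mG : measurable_fun setT G by apply/measurable_EFinP; exact: measurable_int iG.
have mH : measurable_fun setT (fun xs : E * TR =>
    G xs.1 * psi (xs.1 - (clamp01 xs.2 * h) *: delta_mx ord0 i)).
  apply: measurable_funM; first exact: (measurableT_comp mG).
  exact: measurable_along_opp.
have /integrableP[_ iGoo] := iG.
apply: (@integrable01_bounded R n _ (fine (\int[mu]_x `|(G x)%:E|)%E) mH) => s.
rewrite fineK; last by rewrite ge0_fin_numE// integral_ge0.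
apply: ge0_le_integral => //.
- apply: measurableT_comp => //; apply/measurable_EFinP.
  exact: (measurableT_comp mH (measurable_pair2 s)).
- by do 2 apply: measurableT_comp => //.
- by move=> x _; rewrite lee_fin normrM ler_piMr.
Qed.

(** Averaging forwards is adjoint to averaging backwards: exchange the integrals, translate by s h
    e_i for each s, and exchange back. *)
Lemma Rintegral_avgM i h G psi : mu.-integrable setT (EFin \o G) ->
  measurable_fun setT psi -> (forall x, `|psi x| <= 1) ->
  \int[mu]_x \int[nu]_s (G (along i h x s) * psi x) =
  \int[mu]_x (G x * \int[nu]_s psi (x - (clamp01 s * h) *: delta_mx ord0 i)).
Proof.
move=> iG mpsi psi1.
have mG : measurable_fun setT G by apply/measurable_EFinP; exact: measurable_int iG.
have E1 := fubini01 (integrable_along i h iG mpsi psi1).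
have E3 := fubini01 (integrableM_along_opp i h iG mpsi psi1).
rewrite [LHS]E1; transitivity (\int[mu]_x \int[nu]_s
    (G x * psi (x - (clamp01 s * h) *: delta_mx ord0 i))).
  rewrite [RHS]E3; apply: eq_Rintegral => s _ /=.
  rewrite -[RHS](Rintegral_shift ((clamp01 s * h) *: delta_mx ord0 i)).
    by apply: eq_Rintegral => x _; rewrite addrK.
  apply: measurable_funM => //; apply: measurableT_comp => //.
  exact: measurable_addrV.
apply: eq_Rintegral => x _; rewrite RintegralZl//.
exact: integrable_along_opp.
Qed.

Lemma Rintegral_avg_tbump m a b h i G : box_integrable G ->
  h * \int[mu]_x (avg i h G x * tbump m a b x) =
  - \int[mu]_x (G x * tensor (bump_primitive m a b h i) x).
Proof.
(* [W] is [G] cut to a box containing every segment that starts in the support of the bump, as well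
   as the support of the primitive. *)
move=> bG; have [a' [b' [W [iW Wavg WG]]]] : exists a' b' W,
    [/\ mu.-integrable setT (EFin \o W),
       forall x, cbox (a - const_mx 1) (b + const_mx 1) x -> avg i h G x = avg i h W x &
       forall x, W x * tensor (bump_primitive m a b h i) x =
                 G x * tensor (bump_primitive m a b h i) x].
  exists (a - const_mx 1 - const_mx `|h|), (b + const_mx 1 + const_mx `|h|).
  exists (G \_ (cbox (a - const_mx 1 - const_mx `|h|) (b + const_mx 1 + const_mx `|h|))).
  split; [exact: restrict_box_integrable|by move=> x; exact: avg_restrict|].
  move=> x; rewrite patchE; case: ifPn => // /negP; rewrite inE => abx.
  rewrite (_ : tensor _ _ = 0) ?mulr0//.
  apply/eqP/negPn/negP => tx; apply: abx; apply: tensor_neq0 tx => j.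
  have := @bump_primitive_supported _ _ m a b h i j.
  by rewrite !mxE opprD !addrA.
have mt := measurable_tbump m a b.
have t1 x : `|tbump m a b x| <= 1 by rewrite ger0_norm ?tbump_ge0// tbump_le1.
have c1 (x : E) : `|cst (1:R) x| <= 1 by rewrite normr1.
have E1 : \int[mu]_x (avg i h G x * tbump m a b x) =
    \int[mu]_x \int[nu]_s (W (along i h x s) * tbump m a b x).
  congr fine; apply: ae_eq_integral => //.
  - by apply: measurable_int (box_integrable_tbump m a b (box_integrable_avg i h bG)).
  - exact: measurable_int (integrable_fubini01 (integrable_along i h iW mt t1)).
  (* Taking the bump out of the inner integral needs an integrable section, available for almost
     every x only. *)
  have := ae_integrable1 (integrable_along i h iW (measurable_cst _) c1).
  apply: filterS => x ix _.
  have [abx|nabx] := pselect (cbox (a - const_mx 1) (b + const_mx 1) x); last first.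
    rewrite (tbump_supported _ nabx) mulr0.
    under eq_Rintegral do rewrite mulr0.
    by rewrite Rintegral_cst// mul0r.
  rewrite (Wavg _ abx); congr EFin.
  rewrite -[LHS]RintegralZr//.
  by move: ix; apply: eq_integrable => // s _; rewrite /= mulr1.
have tP := test_function_bump_primitive m a b h i.
have intWt : mu.-integrable setT
    (EFin \o (fun x => W x * \int[nu]_s tbump m a b (x - (clamp01 s * h) *: delta_mx ord0 i))).
  have := integrable_fubini01 (integrableM_along_opp i h iW mt t1).
  apply: eq_integrable => // x _ /=; congr EFin.
  rewrite RintegralZl//; exact: integrable_along_opp.
rewrite E1 (Rintegral_avgM i h iW mt t1) -[LHS]RintegralZl// -mulN1r -RintegralZl//; last first.
  exact: test_function_integrable.
apply: eq_Rintegral => x _.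
by rewrite mulrCA avg_tbump mulN1r mulrN WG.
Qed.

Lemma tbump_shift m a b x z : tbump m a b (x + z) = tbump m (a - z) (b - z) x.
Proof.
apply: eq_bigr => j _; rewrite !mxE /boxbump /bump.
congr (expinv _ (_ * _) * expinv _ (_ * _)); ring.
Qed.

(** Tested against a bump, the left difference becomes [v] against the translation difference of the
    bump, which is the i-th derivative of a test function. The hypothesis turns this into an
    integral of [G], and [Rintegral_avg_tbump] recognizes it as the integral of [h * avg i h G]
    against the bump. *)
Lemma weak_difference_quotient i h v G : box_integrable v -> box_integrable G ->
  (forall phi, test_function setT phi ->
    \int[mu]_x (v x * partial i phi x) = - \int[mu]_x (G x * phi x)) ->
  {ae mu, forall x, v (x + h *: delta_mx ord0 i) = v x + h * avg i h G x}.
Proof.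
move=> bv bG vG; set e := delta_mx ord0 i.
have bvh := box_integrable_shift (h *: e) bv.
have bav := box_integrable_avg i h bG.
have bhav : box_integrable (fun x => h * avg i h G x).
  split; first by apply: measurable_funM => //; case: bav.
  by move=> a b; have := integrableZl (measurable_cbox a b) h (bav.2 a b).
suff : {ae mu, forall x, (v (x + h *: e) - v x) - h * avg i h G x = 0}.
  by apply: filterS => x /eqP; rewrite subr_eq0 => /eqP <-; rewrite subrKC.
have EX m a b : \int[mu]_x (v (x + h *: e) * tbump m a b x) =
    \int[mu]_x (v x * tbump m a b (x + - h *: e)).
  rewrite -[RHS](Rintegral_shift (h *: e)).
    by apply: eq_Rintegral => x _; rewrite scaleNr addrK.
  apply: measurable_funM; first exact: bv.1.
  under eq_fun do rewrite tbump_shift; exact: measurable_tbump.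
apply: fundamental_lemma => [|m a b].
  by apply: box_integrableB => //; exact: box_integrableB.
have tt := test_function_tbump m a b.
under eq_Rintegral do rewrite !mulrBl.
rewrite RintegralB//; last 2 first.
- have := test_function_integrable (box_integrableB bvh bv) tt.
  by apply: eq_integrable => // x _ /=; rewrite mulrBl.
- exact: test_function_integrable.
rewrite RintegralB//; last 2 first.
- exact: test_function_integrable.
- exact: test_function_integrable.
under [X in _ - X]eq_Rintegral do rewrite -mulrA.
rewrite [X in _ - X]RintegralZl//; last exact: test_function_integrable.
rewrite Rintegral_avg_tbump// -vG; last exact: test_function_bump_primitive.
under [X in _ - X]eq_Rintegral do rewrite partial_bump_primitive mulrBr.
rewrite [X in _ - X]RintegralB//; last 2 first.
- under [X in _.-integrable _ (_ \o X)]eq_fun do rewrite tbump_shift.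
  exact: box_integrable_tbump.
- exact: box_integrable_tbump.
by rewrite EX subrr.
Qed.

End weak_difference_quotient.

(** * Norm estimates *)

Section Lnorm_toolbox.
Context d (T : measurableType d) (R : realType).
Variable m : {measure set T -> \bar R}.
Implicit Types (f g : T -> R) (p q : \bar R) (c M : R).
Local Open Scope ereal_scope.
Local Notation "'N_ p [ f ]" := (Lnorm m p (EFin \o f)).

Lemma le_poweR (r : R) (x y : \bar R) : (0 <= r)%R -> 0 <= x -> x <= y ->
  x `^ r <= y `^ r.
Proof.
move=> r0 x0 xy; apply: gt0_ler_poweR => //; rewrite in_itv/= leey andbT//.
exact: le_trans xy.
Qed.

Lemma LnormE (r : R) f :
  'N_r%:E[f] = (\int[m]_x (`|f x| `^ r)%:E) `^ r^-1.
Proof. by rewrite unlock. Qed.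

Lemma measurable_norm_powR f (r : R) : measurable_fun setT f ->
  measurable_fun setT (fun x => (`|f x| `^ r)%:E).
Proof.
move=> mf; apply/measurable_EFinP.
apply: (@measurableT_comp _ _ _ _ _ _ (@powR R ^~ r)) => //.
exact: measurableT_comp.
Qed.

Lemma integral_norm_powR_ge0 (f : T -> R) (r : R) : 0 <= \int[m]_x (`|f x| `^ r)%:E.
Proof. by apply: integral_ge0 => x _; rewrite lee_fin powR_ge0. Qed.

Lemma Lnorm_le_ae p f g : 1 <= p -> measurable_fun setT f -> measurable_fun setT g ->
  {ae m, forall x, (`|f x| <= `|g x|)%R} -> 'N_p[f] <= 'N_p[g].
Proof.
move=> p1 mf mg fg; case: p p1 => [r| |//].
  rewrite lee_fin !LnormE => r1; have r0 : (0 <= r)%R by rewrite (le_trans _ r1).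
  apply: le_poweR; [by rewrite invr_ge0|exact: integral_norm_powR_ge0|].
  apply: ae_ge0_le_integral => //.
  - exact: measurable_norm_powR.
  - exact: measurable_norm_powR.
  - by apply: filterS fg => x fgx _; rewrite lee_fin ge0_ler_powR// nnegrE.
(* At +oo the norm is the essential supremum only if the space has positive measure, and 0
   otherwise. *)
move=> _; rewrite unlock /Lnorm; case: ifPn => // _; apply: le_ess_sup.
by apply: filterS fg => x; rewrite /= lee_fin.
Qed.

Lemma eq_Lnorm_ae p f g : 1 <= p -> measurable_fun setT f -> measurable_fun setT g ->
  {ae m, forall x, f x = g x} -> 'N_p[f] = 'N_p[g].
Proof.
move=> p1 mf mg fg; apply/eqP; rewrite eq_le; apply/andP; split;
  apply: Lnorm_le_ae => //; by apply: filterS fg => x ->.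
Qed.

Lemma LnormZE p c f : 1 <= p -> measurable_fun setT f ->
  'N_p[(fun x => c * f x)%R] = `|c|%:E * 'N_p[f].
Proof.
move=> p1 mf; case: p p1 => [r| |//].
  rewrite lee_fin !LnormE => r1; have r0 : (0 < r)%R by rewrite (lt_le_trans _ r1).
  under eq_integral do rewrite normrM powRM// EFinM.
  rewrite ge0_integralZl_EFin ?powR_ge0//; last exact: measurable_norm_powR.
    rewrite poweRM ?lee_fin ?powR_ge0//; last exact: integral_norm_powR_ge0.
    by rewrite poweR_EFin -powRrM mulfV ?gt_eqF// powRr1.
move=> _; rewrite unlock /Lnorm; case: ifPn => m0; last by rewrite mule0.
rewrite -ess_supZl//; congr (ess_sup _ _); apply/funext => x /=.
by rewrite normrM EFinM.
Qed.

Lemma Lnorm_patch_le p f (A : set T) : 1 <= p -> measurable A -> measurable_fun setT f ->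
  'N_p[f \_ A] <= 'N_p[f].
Proof.
move=> p1 mA mf; apply: Lnorm_le_ae => //.
  by apply/(measurable_restrictT _ mA); exact: measurable_funTS.
by apply: nearW => x; rewrite patchE; case: ifPn => // _; rewrite normr0.
Qed.

Lemma powR_le1D (t a b : R) : (0 <= t)%R -> (0 <= a)%R -> (a <= b)%R ->
  (t `^ a <= 1 + t `^ b)%R.
Proof.
move=> t0 a0 ab; have [t1|t1] := leP t 1%R.
  apply: (@le_trans _ _ 1%R); last by rewrite lerDl powR_ge0.
  by apply: (@le_trans _ _ (1 `^ a)%R); [rewrite ge0_ler_powR// nnegrE|rewrite powR1].
apply: (@le_trans _ _ (t `^ b)%R); last by rewrite lerDr.
by rewrite ler_powR// ltW.
Qed.

(** A replacement for the Hoelder inequality with a constant free of the exponents: for a function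
    of norm 1 the integral of the q-th power is at most M + 1, infinite [p] included, and the q-th
    root does not exceed M + 1. *)
Lemma Lnorm_fin_supp q p f (A : set T) M : 1 <= q -> q <= p -> measurable A ->
  m A <= M%:E -> measurable_fun setT f -> (forall x, ~ A x -> f x = 0%R) ->
  'N_q[f] <= (M + 1)%:E * 'N_p[f].
Proof.
move=> q1 qp mA mAM mf f0.
have p1 : 1 <= p := le_trans q1 qp.
have M0 : (0 <= M)%R by rewrite -lee_fin (le_trans _ mAM).
(* The norms 0 and +oo cannot be normalized. In the first case [f] is 0 almost everywhere, in the
   second the bound is infinite. *)
have [K0|K0] := eqVneq 'N_p[f] 0.
  have p0 : 0 < p by rewrite (lt_le_trans _ p1).
  have fae : {ae m, forall x, f x = 0%R}.
    have := Lnorm_eq0_eq0 ((measurable_EFinP _ _).2 mf) p0 K0.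
    by apply: filterS => x /(_ I) [].
  rewrite K0 mule0 (@eq_Lnorm_ae q f (cst 0%R) q1 mf _ fae)//.
  by rewrite Lnorm0 ?gt_eqF// (lt_le_trans _ q1).
have [Koo|Kfin] := eqVneq 'N_p[f] +oo.
  by rewrite Koo gt0_muley ?leey// lte_fin ltr_wpDl.
have Kge0 := Lnorm_ge0 m p (EFin \o f).
have KE : 'N_p[f] = (fine 'N_p[f])%:E.
  by rewrite fineK// ge0_fin_numE// ltey.
have : (0 < fine 'N_p[f])%R by rewrite -lte_fin -KE lt_neqAle eq_sym K0.
move: (fine _) KE => K KE {K0 Kfin Kge0} K0.
(* After normalizing to ['N_p[g] = 1], use [t ^ q <= 1 + t ^ p]. *)
pose g x := (K^-1 * f x)%R.
have mg : measurable_fun setT g by exact: measurable_funM.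
have Ng : 'N_p[g] = 1.
  by rewrite LnormZE// KE -EFinM gtr0_norm ?invr_gt0// mulVf ?gt_eqF.
have -> : f = (fun x => K * g x)%R.
  by apply/funext => x; rewrite /g mulrA mulfV ?mul1r// gt_eqF.
rewrite (LnormZE _ q1 mg) (LnormZE _ p1 mg) Ng mule1 gtr0_norm// muleC lee_pmul2r//.
have g0 x : ~ A x -> g x = 0%R by move=> /f0; rewrite /g => ->; rewrite mulr0.
move: g mg Ng g0 => {f mf f0 KE} g mg Ng g0.
case: q q1 qp => [r| |//]; last first.
  by move=> _; rewrite leye_eq => /eqP pE; rewrite -pE Ng lee_fin lerDr.
rewrite lee_fin => r1 qp; have r0 : (0 < r)%R by rewrite (lt_le_trans _ r1).
have MA1 : (1 <= M + 1)%R by rewrite lerDr.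
rewrite LnormE; apply: (@le_trans _ _ ((M + 1)%:E `^ r^-1)); last first.
  rewrite poweR_EFin lee_fin -[leRHS]powRr1 ?(le_trans _ MA1)//.
  by rewrite ler_powR// invf_le1.
apply: le_poweR; [by rewrite invr_ge0 ltW|exact: integral_norm_powR_ge0|].
have mg1 : measurable_fun setT (fun x => (\1_A x)%:E : \bar R).
  by apply/measurable_EFinP; exact: measurable_indic.
case: p p1 qp Ng => [s| |//].
  rewrite lee_fin => s1; rewrite lee_fin => rs; rewrite LnormE => Ng.
  have s0 : (0 < s)%R by rewrite (lt_le_trans _ s1).
  have {}Ng : \int[m]_x (`|g x| `^ s)%:E = 1.
    have := congr1 (fun y => y `^ s) Ng.
    rewrite -poweRrM mulVf ?gt_eqF// poweR1r poweRe1//.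
    exact: integral_norm_powR_ge0.
  apply: (@le_trans _ _ (\int[m]_x ((\1_A x)%:E + (`|g x| `^ s)%:E))).
    apply: ge0_le_integral => //.
    - exact: measurable_norm_powR.
    - by apply: emeasurable_funD => //; exact: measurable_norm_powR.
    - move=> x _; rewrite -EFinD lee_fin indicE.
      have [Ax|/negP] := boolP (x \in A); first by rewrite powR_le1D// ltW.
      by rewrite inE => /g0 ->; rewrite normr0 !powR0 ?gt_eqF// add0r.
  rewrite ge0_integralD//; last exact: measurable_norm_powR.
  by rewrite Ng integral_indic// setIT EFinD leeD2r.
move=> _ _; rewrite unlock /Lnorm; case: ifPn => mT Ng.
  apply: (@le_trans _ _ (\int[m]_x (\1_A x)%:E)).
    apply: ae_ge0_le_integral => //.
    - exact: measurable_norm_powR.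
    have : ess_sup m (abse \o (EFin \o g)) <= 1 by rewrite Ng.
    move=> /ess_supP; apply: filterS => x /= gx1 _.
    rewrite lee_fin indicE; have [Ax|/negP] := boolP (x \in A).
      apply: (@le_trans _ _ (1 `^ r)%R); last by rewrite powR1.
      by rewrite ge0_ler_powR// ?nnegrE// ?ltW// -lee_fin.
    by rewrite inE => /g0 ->; rewrite normr0 powR0 ?gt_eqF.
  rewrite integral_indic// setIT (le_trans mAM)// lee_fin lerDl//.
by move/eqP: Ng; rewrite eqe eq_sym oner_eq0.
Qed.

Lemma Lnorm_sum_le p (I : Type) (r : seq I) (f : I -> T -> R) : 1 <= p ->
  (forall i, measurable_fun setT (f i)) ->
  'N_p[(fun x => \sum_(i <- r) f i x)%R] <= \sum_(i <- r) 'N_p[f i].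
Proof.
move=> p1 mf; elim: r => [|i r ih].
  under eq_fun do rewrite big_nil.
  by rewrite big_nil Lnorm0// gt_eqF// (lt_le_trans _ p1).
under eq_fun do rewrite big_cons; rewrite big_cons.
apply: le_trans (leeD2l _ ih); apply: eminkowski => //.
exact: measurable_sum.
Qed.

End Lnorm_toolbox.

Section Lnorm_translation.
Context {R : realType} {n : nat}.
Local Notation E := 'rV[R]_n.
Local Notation mu := (@lebesgue_rV R n).
Local Notation TR := (measurableTypeR R).
Local Notation nu := (@unif01 R).
Implicit Types (a b x z : E) (u v f phi psi G : E -> R) (h s t : R) (i : 'I_n).
Implicit Types (p q : \bar R).

Definition weak_partial i v G := forall phi, test_function setT phi ->
  \int[mu]_x (v x * partial i phi x) = - \int[mu]_x (G x * phi x).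

(** Selects the essential supremum in the definition of [Lnorm] at +oo. *)
Lemma lebesgue_rV_gt0 : (0 < mu [set: E])%E.
Proof.
have b01 i : (const_mx 0 : E) ord0 i <= (const_mx 1 : E) ord0 i by rewrite !mxE ler01.
have := lebesgue_rV_box b01; rewrite big1 => [h|i _]; last by rewrite !mxE subr0.
apply: (@lt_le_trans _ _ 1%E); first exact: lte01.
by rewrite -h; apply: le_measure => //; rewrite inE//; exact: measurable_cbox.
Qed.

Lemma Lnorm_shift p f z : (1 <= p)%E -> measurable_fun setT f ->
  ('N[mu]_p[EFin \o (fun x => f (x + z)%R)] = 'N[mu]_p[EFin \o f])%E.
Proof.
move=> + mf; case: p => [r _| _|//].
  by rewrite !LnormE -[in RHS](integral_shift z (measurable_norm_powR r mf)).
rewrite unlock /Lnorm lebesgue_rV_gt0; congr ereal_inf; apply/seteqP; split=> y /=.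
  move=> /(ae_shift (- z)); apply: filterS => x; by rewrite addrNK.
exact: ae_shift.
Qed.

Lemma integral_along (i : 'I_n) h (f : E -> \bar R) : measurable_fun setT f ->
  (forall x, 0 <= f x)%E ->
  (\int[mu]_x \int[nu]_s f (along i h x s) = \int[mu]_x f x)%E.
Proof.
move=> mf f0.
have mfa := measurableT_comp mf (measurable_along i h).
rewrite (tonelli01 mfa (fun xs => f0 _)).
transitivity (\int[nu]_s \int[mu]_x f x)%E.
  apply: eq_integral => s _ /=; rewrite /along.
  by rewrite (integral_shift _ mf).
by rewrite integral_cst// [X in (_ * X)%E]unif01_setT mule1.
Qed.

Lemma measurable_along1 (i : 'I_n) h x : measurable_fun setT (along i h x : TR -> E).
Proof. exact: (measurableT_comp (measurable_along i h) (measurable_pair1 x)). Qed.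

(** The factor 2 is M + 1 in [Lnorm_fin_supp], for the mass M = 1 of [unif01]. *)
Lemma le_avg_Lnorm i h G x (r : R) : 1 <= r -> measurable_fun setT G ->
  (`|avg i h G x|%:E <= 2%:E * 'N[nu]_r%:E[EFin \o (fun s => G (along i h x s))])%E.
Proof.
move=> r1 mG; have mGa := measurableT_comp mG (measurable_along1 i h x).
apply: (@le_trans _ _ 'N[nu]_1[EFin \o (fun s => G (along i h x s))])%E.
  rewrite Lnorm1; apply: le_trans (le_abse_integral _ _ _) => //; last first.
    exact/measurable_EFinP.
  by rewrite /avg /Rintegral; case: (integral _ _ _) => [y| |] //=; rewrite normr0 leey.
apply: (@Lnorm_fin_supp _ _ _ nu 1%E r%:E _ setT 1) => //.
  by rewrite [X in (X <= _)%E]unif01_setT.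
by move=> s; case.
Qed.

(** A crude Minkowski integral inequality: raise the pointwise bound [le_avg_Lnorm] to the power r
    and integrate, using that the average over translates preserves integrals. *)
Lemma Lnorm_avg i h G (r : R) : 1 <= r -> box_integrable G ->
  ('N[mu]_r%:E[EFin \o avg i h G] <= 2%:E * 'N[mu]_r%:E[EFin \o G])%E.
Proof.
move=> r1 bG; have [mG _] := bG; have [mA _] := box_integrable_avg i h bG.
have r0 : 0 < r by rewrite (lt_le_trans _ r1).
rewrite !LnormE; apply: (@le_trans _ _
    (((2%:E `^ r) * \int[mu]_x (`|G x| `^ r)%:E) `^ r^-1)%E); last first.
  rewrite poweRM ?integral_norm_powR_ge0//; last exact: poweR_ge0.
  by rewrite -poweRrM mulfV ?gt_eqF// poweRe1.
apply: le_poweR; [by rewrite invr_ge0 ltW|exact: integral_norm_powR_ge0|].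
rewrite -(@integral_along i h (fun x => (`|G x| `^ r)%:E)); last 2 first.
- exact: measurable_norm_powR.
- by move=> x; rewrite lee_fin powR_ge0.
have mI : measurable_fun setT (fun x => \int[nu]_s (`|G (along i h x s)| `^ r)%:E)%E.
  apply: (@measurable_fun_fubini_tonelli_F _ _ _ _ _ nu
    (fun xs : E * TR => (`|G (along i h xs.1 xs.2)| `^ r)%:E)) => //=.
  exact: (measurableT_comp (measurable_norm_powR _ mG) (measurable_along i h)).
rewrite -ge0_integralZl//; last 2 first.
- by move=> x _; exact: integral_norm_powR_ge0.
- exact: poweR_ge0.
apply: ge0_le_integral => //.
- exact: measurable_norm_powR.
- exact: emeasurable_funM.
move=> x _; have h2 := le_avg_Lnorm i h x r1 mG.
have := le_poweR (ltW r0) _ h2; rewrite lee_fin => /(_ (normr_ge0 _)).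
rewrite poweR_EFin => /le_trans; apply.
rewrite poweRM ?Lnorm_ge0//; apply: lee_wpmul2l; first exact: poweR_ge0.
by rewrite poweR_Lnorm ?gt_eqF.
Qed.

Lemma Lnorm_difference_quotient q i h v G : (1 <= q)%E ->
  box_integrable v -> box_integrable G -> weak_partial i v G ->
  ('N[mu]_q[EFin \o (fun x => v (x + h *: delta_mx ord0 i) - v x)%R] <=
   (`|h| * 2)%:E * 'N[mu]_q[EFin \o G])%E.
Proof.
move=> q1 bv bG vG; have [mv _] := bv; have [mG _] := bG.
have mD : measurable_fun setT (fun x => v (x + h *: delta_mx ord0 i) - v x).
  by apply: measurable_funB => //; case: (box_integrable_shift (h *: delta_mx ord0 i) bv).
case: q q1 => [r| |//].
  rewrite lee_fin => r1; have [mA _] := box_integrable_avg i h bG.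
  apply: (@le_trans _ _ 'N[mu]_r%:E[EFin \o (fun x => h * avg i h G x)%R])%E.
    apply: Lnorm_le_ae => //; first exact: measurable_funM.
    have := weak_difference_quotient h bv bG vG.
    by apply: filterS => x ->; rewrite addrC addKr.
  rewrite LnormZE// EFinM -muleA; apply: lee_wpmul2l; first by rewrite lee_fin.
  exact: Lnorm_avg.
move=> _; have N0 := Lnorm_ge0 mu +oo%E (EFin \o G).
have [->|Koo] := eqVneq ('N[mu]_+oo[EFin \o G])%E +oo%E.
  (* Since 0 * +oo is 0, an infinite norm makes the bound trivial only when [h] is nonzero. *)
  have [h0|h0] := eqVneq h 0.
    rewrite h0 normr0 mul0r mul0e.
    under [X in (EFin \o X)]eq_fun do rewrite scale0r addr0 subrr.
    by rewrite Lnorm0.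
  by rewrite gt0_muley ?leey// lte_fin mulr_gt0// normr_gt0.
have KE : ('N[mu]_+oo[EFin \o G])%E = (fine ('N[mu]_+oo[EFin \o G])%E)%:E.
  by rewrite fineK// ge0_fin_numE// ltey.
move: N0 Koo; rewrite KE lee_fin; move: (fine _) KE => K KE K0 _.
(* Truncating [G] changes it on a null set only, and makes it bounded everywhere
   and not just almost everywhere. *)
pose G' x := Num.max (- K) (Num.min (G x) K).
have GK : {ae mu, forall x, `|G x| <= K}.
  have : (ess_sup mu (abse \o (EFin \o G)) <= K%:E)%E.
    by move: KE; rewrite unlock /Lnorm lebesgue_rV_gt0 => ->.
  by move=> /ess_supP; apply: filterS => x; rewrite /= lee_fin.
have GG' : {ae mu, forall x, G x = G' x}.
  apply: filterS GK => x; rewrite ler_norml => /andP[h1 h2].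
  by rewrite /G' (min_idPl h2) (max_idPr h1).
have G'K x : `|G' x| <= K.
  rewrite ler_norml /G' le_max lexx/= ge_max ge_min lexx orbT andbT.
  by rewrite (le_trans _ K0)// oppr_le0.
have mG' : measurable_fun setT G'.
  by apply: measurable_maxr => //; exact: measurable_minr.
have bG' : box_integrable G'.
  split => // a b; apply: measurable_bounded_integrable.
  - exact: measurable_cbox.
  - exact: lebesgue_cbox_lty.
  - exact: measurable_funTS.
  - exists K; split; first exact: num_real.
    by move=> M KM x _ /=; rewrite (le_trans (G'K x))// ltW.
have vG' : weak_partial i v G'.
  move=> phi tphi; rewrite vG//; congr (- _); congr fine.
  apply: ae_eq_integral => //.
  - exact: measurable_int (test_function_integrable bG tphi).
  - exact: measurable_int (test_function_integrable bG' tphi).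
  - by apply: filterS GG' => x -> _.
rewrite unlock /Lnorm lebesgue_rV_gt0 -EFinM; apply/ess_supP.
have := weak_difference_quotient h bv bG' vG'.
apply: filterS => x; rewrite /= => ->; rewrite addrC addKr lee_fin normrM -mulrA ler_wpM2l//.
rewrite -lee_fin; apply: le_trans (le_avg_Lnorm i h x (lexx 1) mG') _.
rewrite EFinM; apply: lee_wpmul2l => //.
rewrite Lnorm1; apply: (@le_trans _ _ (\int[nu]_s K%:E)%E).
  apply: ge0_le_integral => //.
  - apply: measurableT_comp => //; apply/measurable_EFinP.
    exact: (measurableT_comp mG' (measurable_along1 i h x)).
  - by move=> s _; rewrite lee_fin.
by rewrite integral_cst// [X in (_ * X)%E]unif01_setT mule1.
Qed.

End Lnorm_translation.

Section euclidean_norm.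
Context {R : realType} {n : nat}.
Local Notation E := 'rV[R]_n.
Implicit Types (x : E) (g : E -> E).

Lemma enorm_ge0 x : 0 <= enorm x.
Proof. exact: sqrtr_ge0. Qed.

Lemma coord_le_enorm (i : 'I_n) x : `|x ord0 i| <= enorm x.
Proof.
rewrite -sqrtr_sqr; apply: ler_wsqrtr.
by rewrite (bigD1 i)//= lerDl sumr_ge0// => j _; exact: sqr_ge0.
Qed.

Lemma enorm_le_sum x : enorm x <= \sum_(i < n) `|x ord0 i|.
Proof.
rewrite -[leRHS]ger0_norm ?sumr_ge0// -sqrtr_sqr; apply: ler_wsqrtr.
rewrite expr2 mulr_suml; apply: ler_sum => i _.
rewrite -real_normK ?num_real// expr2 ler_wpM2l// (bigD1 i)//= lerDl.
exact: sumr_ge0.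
Qed.

Lemma measurable_enorm (D : set E) g :
  (forall i, measurable_fun D (fun x => g x ord0 i)) ->
  measurable_fun D (enorm \o g).
Proof.
move=> mg; apply: (measurableT_comp (continuous_measurable_fun (@sqrt_continuous R))).
apply: measurable_sum => i; exact: measurable_funX.
Qed.

End euclidean_norm.

(** * Propagation of local L^q bounds *)

Section local_control.
Context {R : realType} {n : nat}.
Local Notation E := 'rV[R]_n.
Local Notation mu := (@lebesgue_rV R n).
Variables (q : \bar R) (Q : set E).
Hypotheses (q1 : (1 <= q)%E) (mQ : measurable Q).
Implicit Types (A B K : set E) (v : E -> R) (g : E -> E).
Local Notation N f := ('N[mu]_q[EFin \o f])%E.

(** The constant is chosen before [v] and [g]: this uniformity makes the final extension operator
    bounded, and it survives finitely many translations and unions. *)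
Definition controlled A := measurable A /\ exists2 C : R, 0 <= C &
  forall v g, box_integrable v -> weak_gradient setT v g ->
    (N (v \_ A) <= C%:E * (N (v \_ Q) + N (enorm \o g)))%E.

Lemma measurable_patch_rV A v : measurable A -> measurable_fun setT v ->
  measurable_fun setT (v \_ A).
Proof. by move=> mA mv; apply/(measurable_restrictT _ mA); exact: measurable_funTS. Qed.

Lemma controlled_refl : controlled Q.
Proof. by split => //; exists 1 => // v g bv vg; rewrite mul1e leeDl// Lnorm_ge0. Qed.

Lemma controlled_sub A B : measurable A -> A `<=` B -> controlled B -> controlled A.
Proof.
move=> mA AB [mB [C C0 CB]]; split => //; exists C => // v g bv vg.
apply: le_trans (CB v g bv vg); have [mv _] := bv.
apply: Lnorm_le_ae => //; [exact: measurable_patch_rV|exact: measurable_patch_rV|].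
apply: nearW => x; rewrite !patchE; case: ifPn => [|_]; last by rewrite normr0.
by rewrite inE => /AB Bx; rewrite mem_set.
Qed.

Lemma controlled0 : controlled set0.
Proof. exact: (controlled_sub _ _ controlled_refl). Qed.

(** Replacing [B] by its part outside [A] makes the restriction to the union a sum of two
    restrictions, to which Minkowski applies. *)
Lemma controlledU A B : controlled A -> controlled B -> controlled (A `|` B).
Proof.
move=> [mA [C C0 CA]] cB; have mB := cB.1.
have mBA : measurable (B `\` A) by exact: measurableD.
have [_ [D D0 DB]] := controlled_sub mBA (@subDsetl _ B A) cB.
split; first exact: measurableU.
exists (C + D); first exact: addr_ge0.
move=> v g bv vg; have [mv _] := bv.
rewrite EFinD ge0_muleDl ?lee_fin//; apply: le_trans (leeD (CA v g bv vg) (DB v g bv vg)).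
have -> : v \_ (A `|` B) = v \_ A \+ v \_ (B `\` A).
  apply/funext => x; rewrite /= !patchE in_setU in_setD.
  by case: (x \in A); case: (x \in B); rewrite /= ?addr0 ?add0r.
by apply: eminkowski => //; exact: measurable_patch_rV.
Qed.

(** By translation invariance the norm of [v] on the moved set is that of [v (x + z)] on [A], which
    is [v] plus a translation difference. The latter costs 2 |h| times the norm of one coordinate of
    the gradient. *)
Lemma controlled_shift1 (i : 'I_n) (h : R) A : controlled A ->
  controlled ((fun x => x - h *: delta_mx ord0 i) @^-1` A).
Proof.
move=> [mA [C C0 CA]]; set z := h *: delta_mx ord0 i.
have mz : measurable ((fun x : E => x - z) @^-1` A).
  by rewrite -[X in measurable X]setTI; exact: measurable_addrV.
split => //; exists (C + `|h| * 2); first by rewrite addr_ge0// mulr_ge0.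
move=> v g bv vg; have [mv _] := bv; have [bvz _] := box_integrable_shift z bv.
have [/L1loc_setTE bg gi] := vg i.
have -> : v \_ ((fun x : E => x - z) @^-1` A) =
    (fun x => ((fun y => v (y + z)) \_ A) (x - z)).
  by apply/funext => x; rewrite !patchE subrK.
rewrite Lnorm_shift//; last exact: measurable_patch_rV.
have mD : measurable_fun setT (fun x : E => v (x + z) - v x) by exact: measurable_funB.
have -> : (fun y => v (y + z)) \_ A = v \_ A \+ (fun x : E => v (x + z) - v x) \_ A.
  by apply/funext => x; rewrite /= !patchE; case: ifPn => _; rewrite ?addr0// subrKC.
apply: le_trans (eminkowski mu _ _ q1) _; [exact: measurable_patch_rV|exact: measurable_patch_rV|].
rewrite EFinD ge0_muleDl ?lee_fin// ?mulr_ge0//; apply: leeD; first exact: CA.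
apply: le_trans (Lnorm_patch_le mu q1 mA mD) _.
apply: le_trans (Lnorm_difference_quotient _ q1 bv bg gi) _.
apply: lee_wpmul2l; first by rewrite lee_fin mulr_ge0.
apply: le_trans (leeDr _ _); last exact: Lnorm_ge0.
apply: Lnorm_le_ae => //; first by case: bg.
  by apply: measurable_enorm => j; have [/L1loc_setTE[]] := vg j.
by apply: nearW => x /=; rewrite (ger0_norm (enorm_ge0 _)) coord_le_enorm.
Qed.

(** The translation is split into its coordinate steps. *)
Lemma controlled_shift z A : controlled A -> controlled ((fun x => x - z) @^-1` A).
Proof.
move=> cA; rewrite (row_sum_delta z).
elim: (index_enum _) => [|i r ih].
  by under eq_fun do rewrite big_nil subr0.
under eq_fun do rewrite big_cons opprD addrA.
exact: (controlled_shift1 i (z ord0 i) ih).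
Qed.

Lemma controlled_compact x0 (e : R) K : 0 < e -> Q = ball x0 e -> compact K ->
  measurable K -> controlled K.
Proof.
move=> e0 Qx0 cK mK.
have cball y : controlled (ball y e).
  have -> : ball y e = (fun x => x - (y - x0)) @^-1` Q.
    have E x : x0 - (x - (y - x0)) = y - x by rewrite opprB addrA subrKC.
    by rewrite Qx0; apply/seteqP; split => x /=; rewrite -!ball_normE /= E.
  exact: controlled_shift controlled_refl.
move: cK; rewrite compact_cover => /(_ _ K (fun y => ball y e)) [|x Kx|D DK KD].
- by move=> y _; exact: ball_open.
- by exists x => //; exact: ballxx.
have cU : controlled (\bigcup_(y in [set` D]) (ball y e : set E)).
  rewrite bigcup_fset; elim/big_ind: _ => //; first exact: controlled0.
  exact: controlledU.
exact: (controlled_sub mK KD cU).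
Qed.

End local_control.

(** * Comparison of Sobolev norms *)

Section sobolev_norms.
Context {R : realType} {n : nat}.
Local Notation E := 'rV[R]_n.
Local Notation mu := (@lebesgue_rV R n).
Implicit Types (Omega : set E) (u v f : E -> R) (g : E -> E) (p q : \bar R).

Lemma LpnormT p u : Lpnorm setT p u = 'N[mu]_p[EFin \o u]%E.
Proof. by rewrite /Lpnorm patch_setT. Qed.

Lemma grad_weak_gradient Omega u g : weak_gradient Omega u g ->
  weak_gradient Omega u (grad Omega u).
Proof. by move=> ug; rewrite /grad; case: xgetP => [|/(_ g)]. Qed.

(** The disjunction covers both terms of the norm: [f] will be [u] or the Euclidean norm of its
    gradient. *)
Lemma Lpnorm_le_W1p p Omega u f : (1 <= p)%E -> measurable Omega ->
  measurable_fun Omega u -> measurable_fun Omega (enorm \o grad Omega u) ->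
  measurable_fun Omega f ->
  (forall x, `|f x| <= `|u x| \/ `|f x| <= enorm (grad Omega u x)) ->
  (Lpnorm Omega p f <= fnorm (W1p p Omega) u)%E.
Proof.
move=> + mO mu_ me mf fu; rewrite /Lpnorm; case: p => [r| |//].
  rewrite lee_fin LnormE => r1; have r0 : 0 < r by rewrite (lt_le_trans _ r1).
  apply: le_poweR; [by rewrite invr_ge0 ltW|exact: integral_norm_powR_ge0|].
  rewrite [leRHS]integral_mkcond; apply: ge0_le_integral => //.
  - apply: measurable_norm_powR; exact/(measurable_restrictT _ mO).
  - apply/(measurable_restrictT _ mO); apply/measurable_EFinP; apply: measurable_funD.
      apply: (@measurableT_comp _ _ _ _ _ _ (@powR R ^~ r)) => //.
      exact: measurableT_comp.
    by apply: (@measurableT_comp _ _ _ _ _ _ (@powR R ^~ r)).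
  - move=> x _; rewrite !patchE; case: ifPn => _; last first.
      by rewrite normr0 powR0 ?gt_eqF.
    rewrite lee_fin; have [h|h] := fu x.
      by apply: ler_wpDr; [exact: powR_ge0|rewrite ge0_ler_powR ?nnegrE// ltW].
    apply: ler_wpDl; [exact: powR_ge0|rewrite ge0_ler_powR ?nnegrE ?enorm_ge0//].
    exact: ltW.
move=> _; rewrite unlock /Lnorm lebesgue_rV_gt0; apply: le_ess_sup.
apply: nearW => x /=; rewrite lee_fin !patchE; case: ifPn => _; last by rewrite normr0.
have [h|h] := fu x; first by apply: ler_wpDr => //; exact: enorm_ge0.
by apply: ler_wpDl.
Qed.

Lemma weak_gradient_measurable Omega u g : weak_gradient Omega u g ->
  forall i, measurable_fun Omega (fun x => g x ord0 i).
Proof. by move=> ug i; have [[]] := ug i. Qed.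

(** For nonnegative a, b and r >= 1 one has a^r + b^r <= 2 (a + b)^r <= (2 (a + b))^r, so the norm
    is at most that of 2 (|u| + |g|), to which Minkowski applies. *)
Lemma W1p_norm_le q u g : (1 <= q)%E -> measurable_fun setT u ->
  weak_gradient setT u g ->
  (fnorm (W1p q setT) u <=
   2%:E * ('N[mu]_q[EFin \o u] + 'N[mu]_q[EFin \o (enorm \o g)]))%E.
Proof.
move=> q1 mu_ wg; have mg := weak_gradient_measurable wg.
have wG := grad_weak_gradient wg.
have mG := measurable_enorm (weak_gradient_measurable wG).
have ug := weak_gradient_ae_eq wG wg.
have me := measurable_enorm mg.
have mn : measurable_fun setT (fun x => `|u x|) by exact: measurableT_comp.
have mne : measurable_fun setT (fun x => `|u x| + enorm (g x)) by exact: measurable_funD.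
apply: (@le_trans _ _ 'N[mu]_q[EFin \o (fun x => 2 * (`|u x| + enorm (g x)))%R])%E; last first.
  rewrite LnormZE// normr_nat; apply: lee_wpmul2l => //.
  have := eminkowski mu mn me q1.
  by rewrite -(Lnorm_abse _ (EFin \o u)).
case: q q1 => [r| |//].
  rewrite lee_fin LnormE => r1; have r0 : 0 < r by rewrite (lt_le_trans _ r1).
  apply: le_poweR; [by rewrite invr_ge0 ltW|..].
    by apply: integral_ge0 => x _; rewrite lee_fin addr_ge0 ?powR_ge0.
  apply: ae_ge0_le_integral => //.
  - by move=> x _; rewrite lee_fin addr_ge0 ?powR_ge0.
  - apply/measurable_EFinP; apply: measurable_funD.
      apply: (@measurableT_comp _ _ _ _ _ _ (@powR R ^~ r)) => //.
    by apply: (@measurableT_comp _ _ _ _ _ _ (@powR R ^~ r)).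
  - by apply: measurable_norm_powR; exact: measurable_funM.
  - apply: filterS ug => x -> _; rewrite lee_fin.
    have e0 := enorm_ge0 (g x); have u0 := normr_ge0 (u x).
    move: (`|u x|) (enorm (g x)) e0 u0 => a b b0 a0.
    have ab0 : 0 <= a + b by exact: addr_ge0.
    rewrite ger0_norm ?mulr_ge0// powRM//.
    apply: (@le_trans _ _ (2 * (a + b) `^ r)).
      rewrite mulr_natl mulr2n; apply: lerD; apply: ge0_ler_powR;
        by rewrite ?nnegrE ?lerDl ?lerDr// ltW.
    by rewrite ler_wpM2r ?powR_ge0// -[leLHS]powRr1// ler_powR// ler1n.
move=> _; rewrite unlock /Lnorm lebesgue_rV_gt0; apply: le_ess_sup.
apply: filterS ug => x /=; rewrite lee_fin patch_setT => ->.
have ge0 : 0 <= `|u x| + enorm (g x) by rewrite addr_ge0// enorm_ge0.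
by apply: le_trans (ler_norm _); rewrite mulr_natl mulr2n lerDl.
Qed.

End sobolev_norms.

(** * Cutoffs and extension operators *)

Section cutoff_product.
Context {R : realType} {n : nat}.
Local Notation E := 'rV[R]_n.
Local Notation mu := (@lebesgue_rV R n).
Implicit Types (v f phi psi : E -> R) (g : E -> E) (q : \bar R).

Lemma cutoff_bounds (M : R) : exists (psi : E -> R) (B : R) (k : nat),
  [/\ test_function setT psi, forall x, `|x| <= M -> psi x = 1, 0 <= B,
      forall x, `|psi x| <= B /\ forall i, `|partial i psi x| <= B &
      forall x, ~ cube k x -> psi x = 0 /\ forall i, partial i psi x = 0].
Proof.
have [psi [tpsi psi1]] := @exists_cutoff R n M.
have [b0 psib] := test_function_bounded tpsi.
have [k0 psik] := test_function_cube tpsi.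
have /choice[b bP] : forall i, exists c : R, forall x, `|partial i psi x| <= c.
  by move=> i; exact: test_function_bounded (test_function_partial i tpsi).
have /choice[k kP] : forall i, exists k : nat, forall x, ~ cube k x -> partial i psi x = 0.
  by move=> i; exact: test_function_cube (test_function_partial i tpsi).
have b00 : 0 <= b0 by exact: le_trans (psib 0).
have bi0 i : 0 <= b i by exact: le_trans (bP i 0).
have sb0 : 0 <= \sum_i b i by exact: sumr_ge0.
(* Sums dominate the separate bounds, so one constant and one cube serve [psi] and all its partial
   derivatives. *)
exists psi, (b0 + \sum_i b i), (k0 + \sum_i k i)%N; split => //.
- exact: addr_ge0.
- move=> x; split; first by rewrite (le_trans (psib x))// lerDl.
  move=> i; rewrite (le_trans (bP i x))// (bigD1 i)//=.
  by rewrite addrCA lerDl addr_ge0// sumr_ge0.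
- move=> x; rewrite cubeE /= => /negP; rewrite -ltNge => xk; split => [|i].
    apply: psik; rewrite cubeE /=; apply/negP; rewrite -ltNge.
    by apply: le_lt_trans xk; rewrite ler_nat leq_addr.
  apply: kP; rewrite cubeE /=; apply/negP; rewrite -ltNge.
  apply: le_lt_trans xk; rewrite ler_nat (bigD1 i)//= addnCA leq_addr//.
Qed.

Lemma box_integrable_bounded_mul psi v (B : R) : measurable_fun setT psi ->
  (forall x, `|psi x| <= B) -> box_integrable v ->
  box_integrable (fun x => psi x * v x).
Proof.
move=> mpsi psiB [mv iv]; split; first exact: measurable_funM.
move=> a b; have := integrableZl (measurable_cbox a b) B (iv a b).
apply: le_integrable; first exact: measurable_cbox.
  apply/measurable_EFinP; apply: measurable_funTS; exact: measurable_funM.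
move=> x _ /=; rewrite lee_fin !normrM ler_wpM2r//.
by rewrite (le_trans (psiB x))// ler_norm.
Qed.

Lemma box_integrableD v f : box_integrable v -> box_integrable f ->
  box_integrable (fun x => v x + f x).
Proof.
move=> [mv iv] [mf intf]; split; first exact: measurable_funD.
by move=> a b; have := integrableD (measurable_cbox a b) (iv a b) (intf a b).
Qed.

Lemma measurable_test_function phi : test_function setT phi -> measurable_fun setT phi.
Proof.
move=> tphi; apply: continuous_measurable_rV; apply: smooth_continuous.
exact: test_function_smooth.
Qed.

Definition cutoff_gradient psi v g : E -> E :=
  fun x => \row_i (psi x * g x ord0 i + partial i psi x * v x).

(** The product of [psi] and a test function is a test function: testing [v] against it and
    expanding its derivative gives the Leibniz rule. *)
Lemma weak_gradient_cutoff psi v g : test_function setT psi -> box_integrable v ->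
  weak_gradient setT v g ->
  weak_gradient setT (fun x => psi x * v x) (cutoff_gradient psi v g).
Proof.
move=> tpsi bv vg i; have [/L1loc_setTE bg vgi] := vg i.
have tpi := test_function_partial i tpsi.
have mpsi := measurable_test_function tpsi.
have mpi := measurable_test_function tpi.
have [B psiB] := test_function_bounded tpsi.
have [D psiD] := test_function_bounded tpi.
have b1 := box_integrable_bounded_mul mpsi psiB bg.
have b2 := box_integrable_bounded_mul mpi psiD bv.
have -> : (fun x => cutoff_gradient psi v g x ord0 i) =
    (fun x => psi x * g x ord0 i + partial i psi x * v x).
  by apply/funext => x; rewrite mxE.
split; first by apply/L1loc_setTE; exact: box_integrableD.
move=> phi tphi; have sphi := test_function_smooth tphi.
have spsi := test_function_smooth tpsi.
have tpp := test_functionM spsi tphi.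
have := vgi _ tpp => vpp.
under [in RHS]eq_Rintegral do rewrite mxE mulrDl.
rewrite RintegralD//; [|exact: test_function_integrable|exact: test_function_integrable].
rewrite opprD.
have -> : \int[mu]_x (psi x * g x ord0 i * phi x) = - \int[mu]_x (v x * partial i (fun y => psi y * phi y) x).
  by rewrite vpp opprK; apply: eq_Rintegral => x _; ring.
rewrite opprK.
rewrite -RintegralB//; last 2 first.
- exact: test_function_integrable (test_function_partial i tpp).
- exact: test_function_integrable.
by apply: eq_Rintegral => x _; rewrite partialM//; ring.
Qed.

(** One [B] bounds the product itself; the other [n] come from the coordinates of its gradient,
    whose Euclidean norm is at most the sum of their absolute values. *)
Lemma cutoff_norm q psi v g (B : R) (K : set E) : (1 <= q)%E ->
  measurable K -> test_function setT psi -> box_integrable v ->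
  weak_gradient setT v g -> 0 <= B ->
  (forall x, `|psi x| <= B /\ forall i, `|partial i psi x| <= B) ->
  (forall x, ~ K x -> psi x = 0 /\ forall i, partial i psi x = 0) ->
  ('N[mu]_q[EFin \o (fun x => psi x * v x)%R] +
   'N[mu]_q[EFin \o (enorm \o cutoff_gradient psi v g)] <=
   (B + B *+ n)%R%:E * ('N[mu]_q[EFin \o (v \_ K)] + 'N[mu]_q[EFin \o (enorm \o g)]))%E.
Proof.
move=> q1 mK tpsi bv vg B0 psiB psiK; have [mv _] := bv.
have mg := weak_gradient_measurable vg.
have me := measurable_enorm mg.
have mvK := measurable_patch_rV mK mv.
have mpsi := measurable_test_function tpsi.
have mpi i := measurable_test_function (test_function_partial i tpsi).
have wg := weak_gradient_cutoff tpsi bv vg.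
have mcg := weak_gradient_measurable wg.
set Nv := 'N[mu]_q[EFin \o (v \_ K)]%E; set Ng := 'N[mu]_q[EFin \o (enorm \o g)]%E.
have Nv0 : (0 <= Nv)%E by exact: Lnorm_ge0.
have Ng0 : (0 <= Ng)%E by exact: Lnorm_ge0.
have vKE x : K x -> (v \_ K) x = v x by move=> Kx; rewrite patchE mem_set.
have h1 : ('N[mu]_q[EFin \o (fun x => psi x * v x)%R] <= B%:E * (Nv + Ng))%E.
  apply: (@le_trans _ _ (B%:E * Nv)%E); last first.
    by apply: lee_wpmul2l; rewrite ?lee_fin// leeDl.
  have := LnormZE mu B q1 mvK; rewrite (ger0_norm B0) => <-.
  apply: Lnorm_le_ae => //; [exact: measurable_funM|exact: measurable_funM|].
  apply: nearW => x; rewrite !normrM (ger0_norm B0).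
  have [Kx|/psiK[-> _]] := pselect (K x); last by rewrite normr0 mul0r mulr_ge0.
  by rewrite vKE// ler_wpM2r// (psiB x).1.
have h2 i : ('N[mu]_q[EFin \o (fun x => psi x * g x ord0 i + partial i psi x * v x)%R]
    <= B%:E * (Nv + Ng))%E.
  have mBv : measurable_fun setT (fun x => B * (v \_ K) x) by exact: measurable_funM.
  have mBg : measurable_fun setT (fun x => B * (enorm \o g) x) by exact: measurable_funM.
  have mBn : measurable_fun setT (fun x => `|B * (v \_ K) x|) by exact: measurableT_comp.
  rewrite muleDr ?ge0_adde_def ?inE//.
  have := LnormZE mu B q1 mvK; rewrite (ger0_norm B0) => <-.
  have := LnormZE mu B q1 me; rewrite (ger0_norm B0) => <-.
  rewrite -(Lnorm_abse _ (EFin \o (fun x => B * (v \_ K) x))).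
  apply: le_trans (eminkowski mu mBn mBg q1).
  apply: Lnorm_le_ae => //.
  - by apply: measurable_funD; apply: measurable_funM.
  - exact: measurable_funD.
  apply: nearW => x /=.
  rewrite [leRHS]ger0_norm ?addr_ge0 ?mulr_ge0 ?enorm_ge0//.
  apply: le_trans (ler_normD _ _) _; rewrite addrC; apply: lerD.
    rewrite !normrM (ger0_norm B0).
    have [Kx|/psiK[_ ->]] := pselect (K x); last by rewrite normr0 mul0r mulr_ge0.
    by rewrite vKE// ler_wpM2r// (psiB x).2.
  by rewrite normrM; apply: ler_pM => //; [exact: (psiB x).1|exact: coord_le_enorm].
have h3 : ('N[mu]_q[EFin \o (enorm \o cutoff_gradient psi v g)] <=
    (B *+ n)%R%:E * (Nv + Ng))%E.
  apply: (@le_trans _ _ 'N[mu]_q[EFin \o (fun x =>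
      \sum_(i < n) `|cutoff_gradient psi v g x ord0 i|)%R])%E.
    apply: Lnorm_le_ae => //.
    - exact: measurable_enorm.
    - by apply: measurable_sum => i; exact: measurableT_comp.
    apply: nearW => x /=; rewrite (ger0_norm (enorm_ge0 _)).
    by rewrite [leRHS]ger0_norm ?enorm_le_sum// sumr_ge0.
  apply: le_trans (Lnorm_sum_le mu _ q1 _) _.
    by move=> i; exact: measurableT_comp.
  apply: (@le_trans _ _ (\sum_(i < n) (B%:E * (Nv + Ng)))%E).
    apply: lee_sum => i _; apply: le_trans (h2 i).
    have mi := mcg i; have mni : measurable_fun setT
      (fun x => `|cutoff_gradient psi v g x ord0 i|) by exact: measurableT_comp.
    apply: Lnorm_le_ae => //; last by apply: nearW => x; rewrite normr_id mxE.
    by move: mi; congr (measurable_fun _ _); apply/funext => x; rewrite mxE.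
  rewrite -ge0_sume_distrl//.
  by rewrite sumEFin sumr_const card_ord.
by rewrite EFinD ge0_muleDl ?lee_fin ?mulrn_wge0//; exact: leeD.
Qed.

End cutoff_product.

Section cutoff_extension.
Context {R : realType} {n : nat}.
Local Notation E := 'rV[R]_n.
Local Notation mu := (@lebesgue_rV R n).
Implicit Types (Omega : set E) (u v psi : E -> R) (g : E -> E) (p q : \bar R).

Lemma cutoff_control q Omega (M : R) : (1 <= q)%E -> open Omega -> Omega !=set0 ->
  exists psi (C : R), [/\ test_function setT psi,
    forall x, `|x| <= M -> psi x = 1, 0 <= C &
    forall v g, box_integrable v -> weak_gradient setT v g ->
      ('N[mu]_q[EFin \o (fun x => psi x * v x)%R] +
       'N[mu]_q[EFin \o (enorm \o cutoff_gradient psi v g)] <=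
       C%:E * ('N[mu]_q[EFin \o (v \_ Omega)] + 'N[mu]_q[EFin \o (enorm \o g)]))%E].
Proof.
move=> q1 oO [x0 Ox0].
have [psi [B [k [tpsi psi1 B0 psiB psik]]]] := @cutoff_bounds R n M.
have /nbhs_ballP[e /= e0 xeO] : nbhs x0 Omega by exact: open_nbhs_nbhs.
have mK : measurable (cube k : set E) by exact: measurable_cbox.
have mQ := measurable_ball_rV x0 e.
have cK : compact (cube k : set E) by exact: compact_cbox.
have [_ [D D0 DK]] := controlled_compact q1 mQ e0 erefl cK mK.
(* [D] bounds the norm of [v] on the cube by that on a ball inside the domain; the 1 accounts for
   the gradient term of [cutoff_norm]. *)
exists psi, ((B + B *+ n) * (D + 1)); split => //.
  by rewrite mulr_ge0 ?addr_ge0 ?mulrn_wge0.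
move=> v g bv vg; have [mv _] := bv.
have Ng0 := Lnorm_ge0 mu q (EFin \o (enorm \o g)).
have NO0 := Lnorm_ge0 mu q (EFin \o (v \_ Omega)).
apply: le_trans (cutoff_norm q1 mK tpsi bv vg B0 psiB psik) _.
rewrite EFinM -muleA; apply: lee_wpmul2l.
  by rewrite lee_fin addr_ge0// mulrn_wge0.
rewrite EFinD ge0_muleDl// mul1e; apply: leeD; last exact: leeDr.
apply: le_trans (DK v g bv vg) _; apply: lee_wpmul2l; first by rewrite lee_fin.
apply: leeD2r; apply: Lnorm_le_ae => //.
- exact: measurable_patch_rV.
- exact: measurable_patch_rV (open_measurable_rV oO) mv.
apply: nearW => x; rewrite !patchE; case: ifPn => [|_]; last by rewrite normr0.
by rewrite inE => /xeO Ox; rewrite mem_set.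
Qed.

Lemma Lpnorm_bounded q p Omega : (1 <= q)%E -> (q <= p)%E -> bounded_set Omega ->
  measurable Omega -> exists2 C : R, 0 <= C & forall u, measurable_fun Omega u ->
    (Lpnorm Omega q u <= C%:E * Lpnorm Omega p u)%E.
Proof.
move=> q1 qp [M [_ bdO]] mO; pose k := Num.trunc (`|M| + 1).
have Ok : Omega `<=` cube k.+1.
  move=> x /(bdO (`|M| + 1)); rewrite cubeE /= => xM.
  apply: le_trans (xM _) (ltW (truncnS_gt _)).
  by rewrite (le_lt_trans (ler_norm M))// ltrDl.
have multy := lebesgue_cbox_lty (const_mx (- k.+1%:R) : E) (const_mx k.+1%:R).
have mOk : (mu Omega <= (fine (mu (cube k.+1)))%:E)%E.
  rewrite fineK; first by apply: le_measure => //; rewrite inE//; exact: measurable_cbox.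
  by rewrite ge0_fin_numE.
exists (fine (mu (cube k.+1)) + 1); first by rewrite addr_ge0// fine_ge0.
move=> u mfu; apply: (Lnorm_fin_supp q1 qp mO mOk).
  exact/(measurable_restrictT _ mO).
exact: restrict_out0.
Qed.

Lemma Lpnorm_eq_on q Omega u v : (1 <= q)%E -> measurable Omega ->
  measurable_fun Omega u -> measurable_fun Omega v -> ae_eq_on Omega u v ->
  Lpnorm Omega q u = Lpnorm Omega q v.
Proof.
move=> q1 mO mfu mfv uv; apply: eq_Lnorm_ae => //; try exact/(measurable_restrictT _ mO).
by apply: filterS uv => x uvx; rewrite !patchE; case: ifPn => //; rewrite inE => /uvx.
Qed.

End cutoff_extension.

Theorem proposition3p1 (R : realType) (n : nat) (p q : \bar R) :
  (0 < n)%N -> (1 <= q)%E -> (q <= p)%E ->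
  forall Omega : set 'rV[R]_n, is_domain Omega -> bounded_set Omega ->
  extension_domain (L1p p) (L1p q) Omega ->
  extension_domain (W1p p) (W1p q) Omega.
Proof.
move=> _ q1 qp Omega [nzO opO cO] bdO; move=> [T [Tmem Twd Tu [C C0 TC]]].
have p1 := le_trans q1 qp; have mO := open_measurable_rV opO.
have [M [_ OM]] := bdO.
(* Every number above [M] is a bound for the domain; this one fixes the radius on which the cutoff
   is 1. *)
have {}OM x : Omega x -> `|x| <= `|M| + 1.
  by apply: OM; rewrite (le_lt_trans (ler_norm M))// ltrDl.
have [psi [D [tpsi psi1 D0 psiD]]] := cutoff_control (`|M| + 1) q1 opO nzO.
have [F F0 LF] := Lpnorm_bounded q1 qp bdO mO.
have mpsi := measurable_test_function tpsi.
have Tu1 u : fmem (W1p p Omega) u -> ae_eq_on Omega (fun x => psi x * T u x) u.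
  move=> [uL _]; apply: filterS (Tu _ uL) => x Tux Ox.
  by rewrite psi1 ?mul1r ?Tux//; exact: OM.
have bT u : fmem (L1p p Omega) u -> box_integrable (T u).
  by move=> /Tmem[/L1loc_setTE].
(* Membership gives some weak gradient in L^q; uniqueness almost everywhere transfers the bound to
   [grad]. *)
have gT u : fmem (L1p p Omega) u ->
    weak_gradient setT (T u) (grad setT (T u)) /\
    (Lpnorm setT q (enorm \o grad setT (T u)) < +oo)%E.
  move=> /Tmem[_ [g wg [mg]]]; have wG := grad_weak_gradient wg; split => //.
  rewrite LpnormT (@eq_Lnorm_ae _ _ _ _ q _ (enorm \o g))// -?LpnormT//.
    exact: measurable_enorm (weak_gradient_measurable wG).
  by apply: filterS (weak_gradient_ae_eq wG wg) => x /= ->.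
have key u : fmem (W1p p Omega) u ->
    ('N[lebesgue_rV n]_q[EFin \o (fun x => psi x * T u x)%R] +
     'N[lebesgue_rV n]_q[EFin \o (enorm \o cutoff_gradient psi (T u) (grad setT (T u)))] <=
     D%:E * (F%:E * Lpnorm Omega p u + fnorm (L1p q setT) (T u)))%E.
  move=> [uL [mfu _]]; have [wG _] := gT u uL; have [mT _] := bT u uL.
  apply: le_trans (psiD _ _ (bT u uL) wG) _.
  apply: lee_wpmul2l; first by rewrite lee_fin.
  rewrite /fnorm /= LpnormT; apply: leeD2r.
  (* On the domain [T u] is [u], whose L^q norm there is controlled by its L^p norm. *)
  apply: le_trans (LF _ mfu).
  by rewrite -(Lpnorm_eq_on q1 mO _ mfu (Tu u uL))//; exact: measurable_funTS.
exists (fun u x => psi x * T u x); split => //.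
- move=> u uW; have [uL [mfu Lu]] := uW; have [wG Goo] := gT u uL.
  have wc := weak_gradient_cutoff tpsi (bT u uL) wG.
  have [B psiB] := test_function_bounded tpsi.
  have bpT := box_integrable_bounded_mul mpsi psiB (bT u uL).
  have Soo : (D%:E * (F%:E * Lpnorm Omega p u + fnorm (L1p q setT) (T u)) < +oo)%E.
    apply: lte_mul_pinfty => //.
    by apply: lte_add_pinfty => //; apply: lte_mul_pinfty.
  have mcg := measurable_enorm (weak_gradient_measurable wc).
  split; [split; first exact/L1loc_setTE|split; first by case: bpT].
    exists (cutoff_gradient psi (T u) (grad setT (T u))) => //; split => //.
    rewrite LpnormT (le_lt_trans _ Soo)// (le_trans _ (key u uW))// leeDr//.
    exact: Lnorm_ge0.
  rewrite LpnormT (le_lt_trans _ Soo)// (le_trans _ (key u uW))// leeDl//.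
  exact: Lnorm_ge0.
- move=> u v [uL _] [vL _] uv; apply: filterS (Twd u v uL vL uv) => x h Ox.
  by rewrite h.
(* The 2 comes from [W1p_norm_le], [D] from the cutoff, [F] from passing from L^p to L^q on the
   domain, and [C] from [T]; adding 1 makes the constant positive. *)
- exists (2 * (D * (F + C)) + 1).
    by rewrite ltr_wpDl// !mulr_ge0// addr_ge0// ltW.
  move=> u uW; have [uL [mfu _]] := uW; have [wG _] := gT u uL.
  have [_ [g wg _]] := uL; have wg' := grad_weak_gradient wg.
  have me := measurable_enorm (weak_gradient_measurable wg').
  have wc := weak_gradient_cutoff tpsi (bT u uL) wG.
  have mT : measurable_fun setT (fun x => psi x * T u x).
    by apply: measurable_funM => //; case: (bT u uL).
  set S := fnorm (W1p p Omega) u.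
  have hu : (Lpnorm Omega p u <= S)%E.
    by apply: Lpnorm_le_W1p => // x; left.
  have hg : (Lpnorm Omega p (enorm \o grad Omega u) <= S)%E.
    by apply: Lpnorm_le_W1p => // x; right; rewrite ger0_norm// enorm_ge0.
  have S0 : (0 <= S)%E by apply: le_trans hu; exact: Lnorm_ge0.
  apply: le_trans (W1p_norm_le q1 mT wc) _.
  apply: (@le_trans _ _ ((2 * (D * (F + C)))%:E * S)%E); last first.
    by apply: lee_wpmul2r => //; rewrite lee_fin lerDl.
  rewrite EFinM -muleA; apply: lee_wpmul2l => //.
  apply: le_trans (key u uW) _.
  rewrite EFinM -muleA; apply: lee_wpmul2l; first by rewrite lee_fin.
  rewrite EFinD ge0_muleDl ?lee_fin ?(ltW C0)//; apply: leeD.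
    by apply: lee_wpmul2l; rewrite ?lee_fin.
  apply: le_trans (TC u uL) _.
  by apply: lee_wpmul2l; rewrite ?lee_fin ?(ltW C0).
Qed.
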